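(* Let $f(x)=\sum_{k=0}^\infty a_k x^k$ be an entire function with $a_k>0$ for all $k\ge 0$, and suppose that $$2\sqrt[3]{2}\le q_2(f)\le q_3(f)\le q_4(f)\le \cdots .$$ Then all but a finite number of zeros of $f$ are real and simple.
   Context: For an entire function $f(z)=\sum_{k=0}^\infty a_k z^k$ with real nonzero coefficients, the second quotients of its Taylor coefficients are $q_n(f):=\frac{a_{n-1}^2}{a_{n-2}a_n}$ for $n\ge 2$. *)

(* Defs.v *)
From Stdlib Require Import Reals List.
From Coquelicot Require Import Coquelicot.
Open Scope R_scope.

Definition second_quotient (a : nat -> R) (n : nat) : R :=
  (a (n - 1)%nat) ^ 2 / (a (n - 2)%nat * a n).

Definition entire_with_coeffs (a : nat -> R) (f : C -> C) : Prop :=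
  forall z : C, is_pseries (fun k => RtoC (a k)) z (f z).

Definition simple_zero (f : C -> C) (z : C) : Prop :=
  f z = 0%C /\ exists l : C, is_derive f z l /\ l <> 0%C.

(* Main.v *)
Require Import Defs.
From Stdlib Require Import Reals List Lra Lia Classical.
From Coquelicot Require Import Coquelicot.
Open Scope R_scope.

(** Write [r_k = a_k / a_(k+1)], so that [r_(k+1) / r_k = q_(k+2) >= 5/2]. After
    [z = r_k w], and up to the factor [a_k z^k], the series becomes a Laurent series
    [G_k w], considered on the annulus [q_(k+1)^(-1/2) <= |w| <= q_(k+2)^(1/2)]; these
    annuli cover a neighbourhood of infinity in the [z]-plane. If [p = lim 1 / q_n],
    the [G_k] converge to the theta function [sum_(i in Z) p^(i(i-1)/2) w^i] (which is
    [1 + w] when [p = 0]). By the Jacobi triple product its only zero in the annulus is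
    [-1], and its divided difference with node [-1] is bounded away from [0]. Hence for
    large [k] every zero of [G_k] in the annulus is close to [-1], and [G_k] is
    injective near [-1]: a zero [w] equals its conjugate and is simple. The remaining
    zeros lie in a disc, where there are only finitely many. All estimates are made on
    partial sums, uniformly in the number of terms. *)

(** * Partial sums and divided differences *)

(** Localisation, reality and simplicity all rest on one algebraic identity,
    [G w - G w' = (w - w') * D w w'], in place of a contour argument such as Rouché's theorem. With
    node -1 it turns smallness of [G] at -1 into closeness of its zeros to -1; since [D] is
    Lipschitz, a lower bound near (-1, -1) also gives injectivity there. For theta, which vanishes
    at -1, [D w (-1)] is theta divided by [1 + w], so a product formula bounds it from below. The
    finite form of the triple product suffices: it is a polynomial identity, and no infinite product
    has to converge. The obstacle is that the annuli vary with [k]; when [p = 0] their radii tend to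
    infinity. Termwise convergence must therefore survive multiplication by powers of a varying
    radius, under a majorant uniform in [k]. The bound 5/2 is a rational number just below 2 *
    2^(1/3). Its inverse 2/5 has a square root below 2/3, which keeps the first factor [1 + p w] of
    each half product away from 0 on the annulus. *)

Fixpoint csum (u : nat -> C) (n : nat) : C :=
  match n with O => 0%C | S n => (csum u n + u n)%C end.

Fixpoint rsum (u : nat -> R) (n : nat) : R :=
  match n with O => 0 | S n => rsum u n + u n end.

Lemma csum_ext (u v : nat -> C) (n : nat) :
  (forall i, (i < n)%nat -> u i = v i) -> csum u n = csum v n.
Proof.
  induction n as [|n IH]; simpl; intros H; [easy|].
  rewrite IH by (intros; apply H; lia). rewrite H by lia. easy.
Qed.

Lemma csum_minus (u v : nat -> C) (n : nat) :
  csum (fun i => u i - v i)%C n = (csum u n - csum v n)%C.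
Proof. induction n as [|n IH]; simpl; [ring | rewrite IH; ring]. Qed.

Lemma csum_scal (c : C) (u : nat -> C) (n : nat) :
  csum (fun i => c * u i)%C n = (c * csum u n)%C.
Proof. induction n as [|n IH]; simpl; [ring | rewrite IH; ring]. Qed.

Lemma csum_app (u : nat -> C) (m n : nat) :
  csum u (m + n) = (csum u m + csum (fun i => u (m + i)%nat) n)%C.
Proof.
  induction n as [|n IH]; simpl.
  - rewrite Nat.add_0_r; ring.
  - rewrite Nat.add_succ_r; simpl; rewrite IH; ring.
Qed.

Lemma csum_head (u : nat -> C) (n : nat) :
  csum u (S n) = (u O + csum (fun i => u (S i)) n)%C.
Proof. change (S n) with (1 + n)%nat. rewrite (csum_app u 1 n); simpl; ring. Qed.

Lemma csum_rev (u : nat -> C) (n : nat) :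
  csum (fun i => u (n - S i)%nat) n = csum u n.
Proof.
  induction n as [|n IH]; [easy|].
  rewrite csum_head. simpl (csum u (S n)). rewrite <- IH.
  replace (S n - 1)%nat with n by lia.
  rewrite (csum_ext (fun i => u (S n - S (S i))%nat) (fun i => u (n - S i)%nat));
    [ring | intros; f_equal; lia].
Qed.

Lemma csum_0 (u : nat -> C) (n : nat) :
  (forall i, (i < n)%nat -> u i = 0%C) -> csum u n = 0%C.
Proof.
  intros H; rewrite (csum_ext u (fun _ => 0%C)) by exact H.
  clear H; induction n as [|n IH]; simpl; [easy | rewrite IH; ring].
Qed.

Lemma rsum_le (u v : nat -> R) (n : nat) :
  (forall i, (i < n)%nat -> u i <= v i) -> rsum u n <= rsum v n.
Proof.
  induction n as [|n IH]; simpl; intros H; [lra|].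
  apply Rplus_le_compat; [apply IH; intros|]; apply H; lia.
Qed.

Lemma rsum_ge0 (u : nat -> R) (n : nat) :
  (forall i, (i < n)%nat -> 0 <= u i) -> 0 <= rsum u n.
Proof.
  induction n as [|n IH]; simpl; intros H; [lra|].
  apply Rplus_le_le_0_compat; [apply IH; intros|]; apply H; lia.
Qed.

Lemma rsum_app (u : nat -> R) (m n : nat) :
  rsum u (m + n) = rsum u m + rsum (fun i => u (m + i)%nat) n.
Proof.
  induction n as [|n IH]; simpl.
  - rewrite Nat.add_0_r; ring.
  - rewrite Nat.add_succ_r; simpl; rewrite IH; ring.
Qed.

Lemma rsum_scal (c : R) (u : nat -> R) (n : nat) :
  rsum (fun i => c * u i) n = c * rsum u n.
Proof. induction n as [|n IH]; simpl; [ring | rewrite IH; ring]. Qed.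

Lemma Cmod_csum_le (u : nat -> C) (b : nat -> R) (n : nat) :
  (forall i, (i < n)%nat -> Cmod (u i) <= b i) -> Cmod (csum u n) <= rsum b n.
Proof.
  induction n as [|n IH]; simpl; intros H; [rewrite Cmod_0; lra|].
  eapply Rle_trans; [apply Cmod_triangle|].
  apply Rplus_le_compat; [apply IH; intros|]; apply H; lia.
Qed.

Lemma rsum_geom (q : R) (n : nat) : 0 <= q < 1 -> rsum (pow q) n <= / (1 - q).
Proof.
  intros [Hq Hq1].
  assert (H : rsum (pow q) n = (1 - q ^ n) * / (1 - q)).
  { induction n as [|n IH]; simpl; [field; lra | rewrite IH; field; lra]. }
  assert (0 < / (1 - q)) by (apply Rinv_0_lt_compat; lra).
  assert (0 <= q ^ n) by (apply pow_le; lra).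
  rewrite H; nra.
Qed.

Lemma rsum_geom_half (M : R) (n : nat) :
  0 <= M -> rsum (fun i => M * (/ 2) ^ i) n <= 2 * M.
Proof.
  intros HM; rewrite rsum_scal.
  assert (H := rsum_geom (/ 2) n ltac:(lra)).
  replace (/ (1 - / 2)) with 2 in H by lra. nra.
Qed.

(** Dominated convergence for series: a geometric majorant controls the tail beyond [I], termwise
    limits control the first [I] terms. Nonnegativity makes the bound independent of the number of
    terms. *)
Lemma tannery (x : nat -> nat -> R) (M : R) :
  (forall k i, 0 <= x k i) ->
  (exists k1, forall k i, (k1 <= k)%nat -> x k i <= M * (/ 2) ^ i) ->
  (forall i, is_lim_seq (fun k => x k i) 0) ->
  forall eps, 0 < eps ->
  exists K, forall k N, (K <= k)%nat -> rsum (x k) N <= eps.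
Proof.
  intros H0 [k1 Hd] Hl eps Heps.
  assert (HM : 0 <= M).
  { generalize (H0 k1 O) (Hd k1 O (le_n _)); simpl; lra. }
  assert (HI : exists I, 2 * M * (/ 2) ^ I < eps / 2).
  { destruct (pow_lt_1_zero (/ 2) ltac:(rewrite Rabs_pos_eq; lra)
      (eps / 2 / (2 * M + 1))) as [I HI].
    { apply Rdiv_lt_0_compat; lra. }
    exists I. specialize (HI I (le_n _)).
    rewrite Rabs_pos_eq in HI by (apply pow_le; lra).
    assert (0 < (/ 2) ^ I) by (apply pow_lt; lra).
    apply Rmult_lt_compat_l with (r := 2 * M + 1) in HI; [|lra].
    replace ((2 * M + 1) * (eps / 2 / (2 * M + 1))) with (eps / 2) in HI
      by (field; lra).
    nra. }
  destruct HI as [I HI].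
  assert (HK : exists K, forall k, (K <= k)%nat -> rsum (x k) I < eps / 2).
  { clear HI.
    assert (L : is_lim_seq (fun k => rsum (x k) I) 0).
    { induction I as [|I IH]; simpl; [apply is_lim_seq_const|].
      replace (Finite 0) with (Finite (0 + 0)) by (f_equal; ring).
      apply is_lim_seq_plus'; auto. }
    apply is_lim_seq_spec in L.
    destruct (L (mkposreal (eps / 2) ltac:(lra))) as [K HK]; simpl in HK.
    exists K; intros k Hk; specialize (HK k Hk).
    apply Rabs_def2 in HK; lra. }
  destruct HK as [K HK].
  exists (max K k1); intros k N Hk.
  apply Rle_trans with (rsum (x k) (I + N)).
  { rewrite Nat.add_comm, rsum_app.
    generalize (rsum_ge0 (fun i => x k (N + i)%nat) I (fun i _ => H0 _ _)); lra. }
  rewrite rsum_app.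
  assert (rsum (fun i => x k (I + i)%nat) N <= 2 * (M * (/ 2) ^ I)).
  { eapply Rle_trans;
      [|apply (rsum_geom_half (M * (/ 2) ^ I) N);
        apply Rmult_le_pos; [|apply pow_le]; lra].
    apply rsum_le; intros i _.
    replace (M * (/ 2) ^ I * (/ 2) ^ i) with (M * (/ 2) ^ (I + i))
      by (rewrite pow_add; ring).
    apply Hd; lia. }
  specialize (HK k ltac:(lia)). lra.
Qed.

(** The quotient of [x^n - y^n] by [x - y] in Horner form. It avoids division, so it makes sense for
    [x = y], where it is the derivative of the monomial. *)
Fixpoint divdiff (n : nat) (x y : C) : C :=
  match n with O => 0%C | S n => (x ^ n + y * divdiff n x y)%C end.

Lemma divdiff_spec (n : nat) (x y : C) :
  ((x - y) * divdiff n x y = x ^ n - y ^ n)%C.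
Proof.
  induction n as [|n IH]; simpl; [ring|].
  transitivity ((x - y) * x ^ n + y * ((x - y) * divdiff n x y))%C; [ring|].
  rewrite IH; ring.
Qed.

Lemma divdiff_bound (n : nat) (x y : C) (r : R) :
  Cmod x <= r -> Cmod y <= r -> Cmod (divdiff n x y) <= INR n * r ^ (n - 1).
Proof.
  intros Hx Hy. assert (Hr : 0 <= r) by (generalize (Cmod_ge_0 x); lra).
  destruct n as [|n]; [simpl; rewrite Cmod_0; lra|].
  replace (S n - 1)%nat with n by lia.
  induction n as [|n IH].
  { replace (divdiff 1 x y) with (RtoC 1) by (simpl; ring).
    rewrite Cmod_1; simpl; lra. }
  change (divdiff (S (S n)) x y) with (x ^ S n + y * divdiff (S n) x y)%C.
  eapply Rle_trans; [apply Cmod_triangle|].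
  rewrite Cmod_pow, Cmod_mult, (S_INR (S n)).
  assert (Cmod x ^ S n <= r ^ S n)
    by (apply pow_incr; split; [apply Cmod_ge_0 | easy]).
  assert (Cmod y * Cmod (divdiff (S n) x y) <= r * (INR (S n) * r ^ n))
    by (apply Rmult_le_compat; auto using Cmod_ge_0).
  change (r ^ S n) with (r * r ^ n) in *. lra.
Qed.

Lemma divdiff_bound' (n : nat) (x y : C) (r : R) :
  1 <= r -> Cmod x <= r -> Cmod y <= r -> Cmod (divdiff n x y) <= INR n * r ^ n.
Proof.
  intros Hr Hx Hy. eapply Rle_trans; [apply (divdiff_bound n x y r Hx Hy)|].
  apply Rmult_le_compat_l; [apply pos_INR|]. apply Rle_pow; [easy|lia].
Qed.

(** The recursion adds a difference of powers, itself a divided difference of size [n * r^n], at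
    each step. Summing these gives the factor [n^2], through [n^2 + n <= (n + 1)^2]. *)
Lemma divdiff_lipschitz (n : nat) (x y x' y' : C) (r : R) :
  1 <= r -> Cmod x <= r -> Cmod y <= r -> Cmod x' <= r -> Cmod y' <= r ->
  Cmod (divdiff n x y - divdiff n x' y')
    <= INR n ^ 2 * r ^ n * (Cmod (x - x') + Cmod (y - y')).
Proof.
  intros Hr Hx Hy Hx' Hy'.
  induction n as [|n IH].
  { replace (divdiff 0 x y - divdiff 0 x' y')%C with (RtoC 0) by (simpl; ring).
    rewrite Cmod_0; simpl; lra. }
  change (divdiff (S n) x y) with (x ^ n + y * divdiff n x y)%C.
  change (divdiff (S n) x' y') with (x' ^ n + y' * divdiff n x' y')%C.
  replace (x ^ n + y * divdiff n x y - (x' ^ n + y' * divdiff n x' y'))%C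
    with ((x ^ n - x' ^ n) + (y * (divdiff n x y - divdiff n x' y')
          + (y - y') * divdiff n x' y'))%C by ring.
  rewrite <- divdiff_spec.
  eapply Rle_trans; [apply Cmod_triangle|].
  eapply Rle_trans;
    [apply Rplus_le_compat_l, Cmod_triangle|]. rewrite !Cmod_mult.
  assert (B1 := divdiff_bound' n x x' r Hr Hx Hx').
  assert (B2 := divdiff_bound' n x' y' r Hr Hx' Hy').
  set (dx := Cmod (x - x')) in *. set (dy := Cmod (y - y')) in *.
  assert (0 <= dx) by apply Cmod_ge_0. assert (0 <= dy) by apply Cmod_ge_0.
  assert (P : 0 < r ^ n) by (apply pow_lt; lra).
  assert (N := pos_INR n).
  assert (A1 : dx * Cmod (divdiff n x x') <= dx * (INR n * r ^ n))
    by (apply Rmult_le_compat_l; easy).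
  assert (A2 : dy * Cmod (divdiff n x' y') <= dy * (INR n * r ^ n))
    by (apply Rmult_le_compat_l; easy).
  assert (A3 : Cmod y * Cmod (divdiff n x y - divdiff n x' y')
          <= r * (INR n ^ 2 * r ^ n * (dx + dy)))
    by (apply Rmult_le_compat; auto using Cmod_ge_0).
  rewrite S_INR. change (r ^ S n) with (r * r ^ n).
  assert (INR n * r ^ n * (dx + dy) <= r * (INR n * r ^ n * (dx + dy))).
  { assert (0 <= INR n * r ^ n * (dx + dy))
      by (repeat apply Rmult_le_pos; lra). nra. }
  assert (0 <= r * r ^ n * (dx + dy) * (INR n + 1))
    by (repeat apply Rmult_le_pos; lra).
  nra.
Qed.

(** [v] and [v'] stand for [/ w] and [/ w']; in all uses [be 0 = 0], so that the constant
    term is [al 0]. *)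
Definition laurent (al be : nat -> R) (N : nat) (w v : C) : C :=
  (csum (fun i => RtoC (al i) * w ^ i) N + csum (fun i => RtoC (be i) * v ^ i) N)%C.

(** The negative side is differenced in [v]; the factor [- v * v'] converts [v - v'] into [w - w']
    when [v = / w] and [v' = / w']. *)
Definition laurent_dd (al be : nat -> R) (N : nat) (w v w' v' : C) : C :=
  (csum (fun i => RtoC (al i) * divdiff i w w') N
   - v * v' * csum (fun i => RtoC (be i) * divdiff i v v') N)%C.

Lemma laurent_diff (al be : nat -> R) (N : nat) (w v w' v' : C) :
  (w * v = 1 -> w' * v' = 1 ->
   laurent al be N w v - laurent al be N w' v'
   = (w - w') * laurent_dd al be N w v w' v')%C.
Proof.
  intros H H'. unfold laurent, laurent_dd.
  transitivity ((csum (fun i => RtoC (al i) * w ^ i) N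
    - csum (fun i => RtoC (al i) * w' ^ i) N)
    + (csum (fun i => RtoC (be i) * v ^ i) N
    - csum (fun i => RtoC (be i) * v' ^ i) N))%C; [ring|].
  rewrite <- !csum_minus.
  rewrite (csum_ext _ (fun i => (w - w') * (RtoC (al i) * divdiff i w w'))%C).
  2: { intros i _. transitivity (RtoC (al i) * (w ^ i - w' ^ i))%C; [ring|].
       rewrite <- divdiff_spec; ring. }
  rewrite (csum_ext (fun i => RtoC (be i) * v ^ i - RtoC (be i) * v' ^ i)%C
    (fun i => (v - v') * (RtoC (be i) * divdiff i v v'))%C).
  2: { intros i _. transitivity (RtoC (be i) * (v ^ i - v' ^ i))%C; [ring|].
       rewrite <- divdiff_spec; ring. }
  rewrite !csum_scal.
  assert (E : (v - v' = - (w - w') * (v * v'))%C).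
  { transitivity ((w' * v') * v - (w * v) * v')%C; [rewrite H, H'; ring | ring]. }
  rewrite E; ring.
Qed.

Definition weight (al al' : nat -> R) (r : R) (i : nat) : R :=
  Rabs (al i - al' i) * (INR i * r ^ (i - 1)).

(** One power of [r] more than in [weight]: the factor [v * v'] of [laurent_dd], with [v' = -1],
    contributes another [v]. *)
Definition weight' (be be' : nat -> R) (r : R) (i : nat) : R :=
  Rabs (be i - be' i) * (INR i * r ^ i).

Lemma laurent_dd_compare (al be al' be' : nat -> R) (N : nat) (w v : C) (r r' : R) :
  1 <= r -> 1 <= r' -> Cmod w <= r -> Cmod v <= r' ->
  Cmod (laurent_dd al be N w v (-(1)) (-(1)) - laurent_dd al' be' N w v (-(1)) (-(1)))
    <= rsum (weight al al' r) N + rsum (weight' be be' r') N.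
Proof.
  intros Hr Hr' Hw Hv. unfold laurent_dd.
  match goal with |- Cmod (?a - ?b * ?c - (?d - ?b * ?e)) <= _ =>
    replace (a - b * c - (d - b * e))%C with ((a - d) + - b * (c - e))%C by ring end.
  rewrite <- !csum_minus.
  eapply Rle_trans; [apply Cmod_triangle|].
  apply Rplus_le_compat.
  - apply Cmod_csum_le; intros i _. unfold weight.
    replace (RtoC (al i) * divdiff i w (- (1)) - RtoC (al' i) * divdiff i w (- (1)))%C
      with (RtoC (al i - al' i) * divdiff i w (- (1)))%C by (rewrite RtoC_minus; ring).
    rewrite Cmod_mult, Cmod_R. apply Rmult_le_compat_l; [apply Rabs_pos|].
    apply divdiff_bound; [easy | rewrite Cmod_m1; easy].
  - rewrite <- csum_scal. apply Cmod_csum_le; intros i _. unfold weight'.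
    replace (- (v * - (1)) * (RtoC (be i) * divdiff i v (- (1))
        - RtoC (be' i) * divdiff i v (- (1))))%C
      with (RtoC (be i - be' i) * (v * divdiff i v (- (1))))%C
      by (rewrite RtoC_minus; ring).
    rewrite Cmod_mult, Cmod_R. apply Rmult_le_compat_l; [apply Rabs_pos|].
    rewrite Cmod_mult.
    destruct i as [|i]; [simpl; rewrite Cmod_0; lra|].
    assert (B := divdiff_bound (S i) v (-(1)) r' Hv ltac:(rewrite Cmod_m1; easy)).
    replace (S i - 1)%nat with i in B by lia.
    apply Rle_trans with (r' * (INR (S i) * r' ^ i)).
    + apply Rmult_le_compat; auto using Cmod_ge_0.
    + simpl (r' ^ S i); lra.
Qed.

(** For positive indices the weights dominate the plain coefficient differences, because [i] and the
    radii are at least 1. They vanish at index 0, hence the requirement that the constant terms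
    agree. *)
Lemma laurent_compare_m1 (al be al' be' : nat -> R) (N : nat) (r r' : R) :
  1 <= r -> 1 <= r' -> al O = al' O -> be O = be' O ->
  Cmod (laurent al be N (-(1)) (-(1)) - laurent al' be' N (-(1)) (-(1)))
    <= rsum (weight al al' r) N + rsum (weight' be be' r') N.
Proof.
  intros Hr Hr' Ha Hb. unfold laurent.
  match goal with |- Cmod (?a + ?b - (?c + ?d)) <= _ =>
    replace (a + b - (c + d))%C with ((a - c) + (b - d))%C by ring end.
  rewrite <- !csum_minus.
  eapply Rle_trans; [apply Cmod_triangle|].
  assert (P : forall s i j, 1 <= s -> 1 <= INR (S i) * s ^ j).
  { intros s i j Hs. generalize (pow_R1_Rle s j Hs) (pos_INR i); rewrite S_INR; nra. }
  apply Rplus_le_compat; apply Cmod_csum_le; intros i _; unfold weight, weight'.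
  - replace (RtoC (al i) * (- (1)) ^ i - RtoC (al' i) * (- (1)) ^ i)%C
      with (RtoC (al i - al' i) * (- (1)) ^ i)%C by (rewrite RtoC_minus; ring).
    rewrite Cmod_mult, Cmod_R, Cmod_pow, Cmod_m1, pow1.
    destruct i as [|i]; [rewrite Ha, Rminus_diag, Rabs_R0; lra|].
    generalize (P r i (S i - 1)%nat Hr) (Rabs_pos (al (S i) - al' (S i))); nra.
  - replace (RtoC (be i) * (- (1)) ^ i - RtoC (be' i) * (- (1)) ^ i)%C
      with (RtoC (be i - be' i) * (- (1)) ^ i)%C by (rewrite RtoC_minus; ring).
    rewrite Cmod_mult, Cmod_R, Cmod_pow, Cmod_m1, pow1.
    destruct i as [|i]; [rewrite Hb, Rminus_diag, Rabs_R0; lra|].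
    generalize (P r' i (S i) Hr') (Rabs_pos (be (S i) - be' (S i))); nra.
Qed.

(** * Truncated theta series *)

(** The triangular number n(n-1)/2, the exponent of the theta series. *)
Fixpoint tri (n : nat) : nat := match n with O => O | S n => (tri n + n)%nat end.

(** The factors in front are those of [divdiff_lipschitz] at radius 2. The constant is 256 = 4 * 64,
    from [(i + 1)^2 <= 4 * 2^i] and [2^(- tri i) <= 64 * 8^(-i)]. *)
Lemma tri_decay :
  exists M, 0 <= M /\
    forall i, (INR i + 1) ^ 2 * 2 ^ i * (/ 2) ^ tri i <= M * (/ 2) ^ i.
Proof.
  exists 256; split; [lra|]; intros i.
  (* The difference of the two sides is (i-3)(i-4)/2. *)
  assert (T : (3 * i <= 6 + tri i)%nat).
  { assert (E : (2 * tri i + i = i * i)%nat) by (induction i; simpl; nia).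
    destruct (Nat.le_gt_cases i 3); nia. }
  assert (Q : (INR i + 1) ^ 2 <= 4 * 2 ^ i).
  { clear T; induction i as [|i IH]; [simpl; lra|].
    destruct i as [|[|i]]; [simpl; lra..|].
    rewrite S_INR. change (2 ^ S (S (S i))) with (2 * 2 ^ S (S i)).
    assert (2 <= INR (S (S i))) by (rewrite !S_INR; generalize (pos_INR i); lra).
    nra. }
  assert (E : (/ 2) ^ tri i <= 64 * (/ 2) ^ (3 * i)).
  { apply Rmult_le_reg_r with ((/ 2) ^ 6); [apply pow_lt; lra|].
    replace (64 * (/ 2) ^ (3 * i) * (/ 2) ^ 6) with ((/ 2) ^ (3 * i)) by (simpl; field).
    rewrite <- pow_add, !pow_inv.
    apply Rinv_le_contravar; [apply pow_lt; lra | apply Rle_pow; [lra|lia]]. }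
  assert (P : 0 < 2 ^ i) by (apply pow_lt; lra).
  assert (P' : 0 < (/ 2) ^ i) by (apply pow_lt; lra).
  assert (PE : 2 ^ i * (/ 2) ^ i = 1) by (rewrite <- Rpow_mult_distr, Rinv_r, pow1; lra).
  rewrite Nat.mul_comm, pow_mult in E.
  apply Rle_trans with (4 * 2 ^ i * 2 ^ i * (64 * ((/ 2) ^ i) ^ 3)).
  - apply Rmult_le_compat; try easy.
    + apply Rmult_le_pos; [apply pow2_ge_0 | lra].
    + apply pow_le; lra.
    + apply Rmult_le_compat_r; lra.
  - replace (4 * 2 ^ i * 2 ^ i * (64 * ((/ 2) ^ i) ^ 3))
      with (256 * (2 ^ i * (/ 2) ^ i) ^ 2 * (/ 2) ^ i) by ring.
    rewrite PE; lra.
Qed.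

(** Majorants for the terms on the annulus [1/r' <= |w| <= r], with [al] on the positive and
    [be] on the negative side; the divided differences of [w^i] are of size [i * r^(i-1)],
    hence the shift of the index in [dominated]. *)
Definition dominated (al : nat -> R) (r : R) : Prop :=
  forall i, 0 <= al (S i) /\ al (S i) * r ^ i <= (/ 2) ^ tri i.

Definition dominated' (be : nat -> R) (r : R) : Prop :=
  forall i, 0 <= be i /\ be i * r ^ i <= (/ 2) ^ tri i.

(** [tannery] applied to both sides of the Laurent sum. The radii depend on [k], so the coefficient
    differences are required to tend to 0 only after multiplication by the power of the current
    radius. *)
Lemma laurent_limit (al be : nat -> nat -> R) (al' be' : nat -> nat -> R)
    (r r' : nat -> R) :
  (forall k, 1 <= r k) -> (forall k, 1 <= r' k) ->
  (exists k1, forall k, (k1 <= k)%nat -> dominated (al k) (r k) /\ dominated (al' k) (r k)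
    /\ dominated' (be k) (r' k) /\ dominated' (be' k) (r' k)) ->
  (forall i, is_lim_seq (fun k => (al k (S i) - al' k (S i)) * r k ^ i) 0) ->
  (forall i, is_lim_seq (fun k => (be k i - be' k i) * r' k ^ i) 0) ->
  forall eps, 0 < eps -> exists K, forall k N, (K <= k)%nat ->
    rsum (weight (al k) (al' k) (r k)) N
    + rsum (weight' (be k) (be' k) (r' k)) N <= eps.
Proof.
  intros Hr Hr' [k1 Hk1] La Lb eps Heps.
  destruct tri_decay as [M [HM Hdec]].
  assert (AB : forall a b c x, 0 <= a -> 0 <= b -> 0 <= c -> a * c <= x -> b * c <= x ->
    Rabs (a - b) * c <= x).
  { intros a b c x Ha Hb Hc H1 H2. unfold Rabs; destruct (Rcase_abs (a - b)); nra. }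
  assert (Dec : forall i, (INR i + 1) * (/ 2) ^ tri i <= M * (/ 2) ^ i).
  { intros i. eapply Rle_trans; [|apply Hdec].
    apply Rmult_le_compat_r; [apply pow_le; lra|].
    generalize (pos_INR i) (pow_R1_Rle 2 i ltac:(lra)); intros.
    assert (1 <= (INR i + 1) * 2 ^ i) by nra. nra. }
  assert (Pr : forall k i, 0 < r k ^ i).
  { intros k i; apply pow_lt; generalize (Hr k); lra. }
  assert (Pr' : forall k i, 0 < r' k ^ i).
  { intros k i; apply pow_lt; generalize (Hr' k); lra. }
  assert (lim0 : forall (u : nat -> R) c, is_lim_seq u 0 ->
    is_lim_seq (fun k => Rabs (u k) * c) 0).
  { intros u c Hu. apply is_lim_seq_abs_0 in Hu.
    replace (Finite 0) with (Rbar_mult (Finite 0) (Finite c))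
      by (simpl; f_equal; ring).
    apply is_lim_seq_scal_r, Hu. }
  (* The index shift in [dominated] bounds the weight at [S i] by [M * (/ 2) ^ i], hence the doubled
     constant. *)
  destruct (tannery (fun k => weight (al k) (al' k) (r k)) (2 * M)) with (eps := eps / 2)
    as [K1 HK1]; [| | |lra|].
  - intros k i. unfold weight. apply Rmult_le_pos; [apply Rabs_pos|].
    apply Rmult_le_pos; [apply pos_INR | left; apply Pr].
  - exists k1; intros k i Hk; unfold weight. destruct (Hk1 k Hk) as [D [D' _]].
    destruct i as [|i].
    { simpl; rewrite Rmult_0_l, Rmult_0_r; lra. }
    replace (S i - 1)%nat with i by lia.
    destruct (D i) as [D1 D2], (D' i) as [D1' D2'].
    assert (A := AB _ _ _ _ D1 D1' (Rlt_le _ _ (Pr k i)) D2 D2').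
    rewrite S_INR. generalize (Dec i) (pos_INR i); simpl; intros.
    replace (2 * M * (/ 2 * (/ 2) ^ i)) with (M * (/ 2) ^ i) by field.
    nra.
  - intros i. destruct i as [|i].
    { eapply is_lim_seq_ext; [|apply is_lim_seq_const].
      intros k; unfold weight; simpl; ring. }
    eapply is_lim_seq_ext; [|apply (lim0 _ (INR (S i)) (La i))].
    intros k; unfold weight. cbv beta. replace (S i - 1)%nat with i by lia.
    rewrite Rabs_mult, (Rabs_pos_eq (r k ^ i)) by (left; apply Pr). ring.
  - destruct (tannery (fun k => weight' (be k) (be' k) (r' k)) M) with (eps := eps / 2)
      as [K2 HK2]; [| | |lra|].
    + intros k i. unfold weight'. apply Rmult_le_pos; [apply Rabs_pos|].
      apply Rmult_le_pos; [apply pos_INR | left; apply Pr'].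
    + exists k1; intros k i Hk; unfold weight'. destruct (Hk1 k Hk) as [_ [_ [D D']]].
      destruct (D i) as [D1 D2], (D' i) as [D1' D2'].
      assert (A := AB _ _ _ _ D1 D1' (Rlt_le _ _ (Pr' k i)) D2 D2').
      generalize (Dec i) (pos_INR i); intros.
      assert (0 <= (/ 2) ^ tri i) by (apply pow_le; lra). nra.
    + intros i.
      eapply is_lim_seq_ext; [|apply (lim0 _ (INR i) (Lb i))].
      intros k; unfold weight'. cbv beta.
      rewrite Rabs_mult, (Rabs_pos_eq (r' k ^ i)) by (left; apply Pr'). ring.
    + exists (max K1 K2); intros k N Hk.
      generalize (HK1 k N ltac:(lia)) (HK2 k N ltac:(lia)); lra.
Qed.

Definition theta_pos (p : R) (i : nat) : R := p ^ tri i.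

(** The exponent at index -i is (-i)(-i-1)/2 = i(i+1)/2, that is [tri (S i)]. *)
Definition theta_neg (p : R) (i : nat) : R :=
  match i with O => 0 | S _ => p ^ tri (S i) end.

Lemma laurent_S (al be : nat -> R) (N : nat) (w v : C) :
  laurent al be (S N) w v
  = (laurent al be N w v + (RtoC (al N) * w ^ N + RtoC (be N) * v ^ N))%C.
Proof. unfold laurent; simpl; ring. Qed.

(** At -1 the terms of index [i + 1] and [-i] carry the same power of [p] with opposite signs. They
    cancel in pairs, and only the term of index [-N] lacks its partner. *)
Lemma theta_m1 (p : R) (N : nat) :
  laurent (theta_pos p) (theta_neg p) (S N) (-(1)) (-(1))
  = (RtoC (p ^ tri (S N)) * (- (1)) ^ N)%C.
Proof.
  induction N as [|N IH].
  { unfold laurent; simpl. change (theta_pos p 0) with 1. ring. }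
  rewrite laurent_S.
  rewrite IH. unfold theta_pos, theta_neg. rewrite !Cpow_S. ring.
Qed.

Lemma theta_m1_small (p : R) : 0 <= p <= 2 / 5 -> forall eps, 0 < eps ->
  exists N0, forall N, (N0 <= N)%nat ->
  Cmod (laurent (theta_pos p) (theta_neg p) N (-(1)) (-(1))) <= eps.
Proof.
  intros Hp eps Heps.
  destruct (pow_lt_1_zero p ltac:(rewrite Rabs_pos_eq; lra) eps Heps) as [N1 H1].
  exists (S N1); intros [|N] HN; [lia|].
  rewrite theta_m1, Cmod_mult, Cmod_R, Cmod_pow, Cmod_m1, pow1, Rmult_1_r.
  simpl tri. rewrite pow_add, Rabs_mult.
  specialize (H1 N ltac:(lia)).
  rewrite (Rabs_pos_eq (p ^ (tri N))) by (apply pow_le; lra).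
  assert (0 <= p ^ tri N <= 1).
  { split; [apply pow_le; lra|]. rewrite <- (pow1 (tri N)). apply pow_incr; lra. }
  simpl.
  generalize (Rabs_pos (p ^ N)); nra.
Qed.

(** * The finite triple product *)

(** Coefficients of [d k * (r * w)^k * laurent _ _ _ w (/ w)], the polynomial with
    coefficients [d] recentred at its [k]-th term and rescaled by [r]. *)
Definition coef_pos (d : nat -> R) (k : nat) (r : R) (i : nat) : R :=
  d (k + i)%nat / d k * r ^ i.

Definition coef_neg (d : nat -> R) (k : nat) (r : R) (i : nat) : R :=
  match i with
  | O => 0
  | S _ => if (i <=? k)%nat then d (k - i)%nat / d k / r ^ i else 0
  end.

Lemma coef_neg_gt (d : nat -> R) (k : nat) (r : R) (i : nat) :
  (k < i)%nat -> coef_neg d k r i = 0.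
Proof.
  intros H; destruct i as [|i]; [easy|]; unfold coef_neg.
  destruct (Nat.leb_spec (S i) k); [lia | easy].
Qed.

(** Exact, with no truncation error: the positive side takes the [N] terms from index [k] on, the
    negative side the [k] terms below it, and [k < N] pads the rest with the zeros of [coef_neg]. *)
Lemma laurent_recentre (d : nat -> R) (k N : nat) (r : R) (w v : C) :
  d k <> 0 -> 0 < r -> (w * v = 1)%C -> (k < N)%nat ->
  csum (fun j => RtoC (d j) * (RtoC r * w) ^ j)%C (k + N)
  = (RtoC (d k) * (RtoC r * w) ^ k
     * laurent (coef_pos d k r) (coef_neg d k r) N w v)%C.
Proof.
  intros Hd Hr Hwv HN.
  assert (Hd' : RtoC (d k) <> 0%C) by (intro H; apply RtoC_inj in H; easy).
  assert (Hr' : RtoC r <> 0%C) by (intro H; apply RtoC_inj in H; lra).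
  assert (Hrp : forall i, r ^ i <> 0) by (intro; apply pow_nonzero; lra).
  set (z := (RtoC r * w)%C).
  rewrite csum_app, <- (csum_rev _ k). unfold laurent.
  match goal with |- _ = (?c * (?a + ?b))%C =>
    transitivity (c * b + c * a)%C; [|ring] end.
  rewrite <- !csum_scal. f_equal.
  - replace N with (S k + (N - S k))%nat by lia.
    rewrite csum_app, csum_head.
    rewrite (csum_0 (fun i => _ * (RtoC (coef_neg d k r (S k + i)) * _))%C).
    2: { intros i _. rewrite coef_neg_gt by lia. ring. }
    change (coef_neg d k r 0) with 0.
    match goal with |- ?a = (_ + ?b + _)%C => transitivity b; [|ring] end.
    apply csum_ext; intros i Hi. unfold coef_neg.
    destruct (Nat.leb_spec (S i) k); [|lia].
    assert (Ek : (z ^ k = z ^ (k - S i) * z ^ S i)%C)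
      by (rewrite <- Cpow_add_r; f_equal; lia).
    rewrite Ek. unfold z at 3. rewrite Cpow_mult_l.
    rewrite !RtoC_div, RtoC_pow by auto.
    assert (Hc : (w ^ S i * v ^ S i = 1)%C)
      by (rewrite <- Cpow_mult_l, Hwv; apply Cpow_1_l).
    transitivity (RtoC (d (k - S i)%nat) * z ^ (k - S i) * (w ^ S i * v ^ S i))%C;
      [rewrite Hc; ring|].
    field. repeat split; auto using Cpow_nz.
  - apply csum_ext; intros i _. unfold coef_pos.
    rewrite Cpow_add_r. unfold z at 2. rewrite Cpow_mult_l.
    rewrite RtoC_mult, RtoC_div, RtoC_pow by auto. field. easy.
Qed.

(** The q-Pochhammer symbol (-x; p)_n. *)
Fixpoint qprod (p : R) (n : nat) (x : C) : C :=
  match n with O => 1%C | S n => (qprod p n x * (1 + RtoC (p ^ n) * x))%C end.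

(** [p ^ tri j] times the Gaussian binomial coefficient of [n] over [j] in base [p], generated by
    the Pascal rule for multiplication by [1 + p^n x]. *)
Fixpoint qcoef (p : R) (n j : nat) : R :=
  match n, j with
  | O, O => 1
  | O, S _ => 0
  | S n, O => qcoef p n O
  | S n, S j => qcoef p n (S j) + p ^ n * qcoef p n j
  end.

Lemma qprod_expand (p : R) (n N : nat) (x : C) : (n < N)%nat ->
  csum (fun j => RtoC (qcoef p n j) * x ^ j)%C N = qprod p n x.
Proof.
  revert N; induction n as [|n IH]; intros N HN.
  - destruct N as [|N]; [lia|]. rewrite csum_head, csum_0; [simpl; ring|].
    intros; simpl; ring.
  - destruct N as [|N]; [lia|].
    assert (E1 := IH (S N) ltac:(lia)). assert (E2 := IH N ltac:(lia)).
    rewrite csum_head in E1 |- *. change (qprod p (S n) x)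
      with (qprod p n x * (1 + RtoC (p ^ n) * x))%C.
    transitivity (qprod p n x + qprod p n x * (RtoC (p ^ n) * x))%C; [|ring].
    rewrite <- E1 at 1. rewrite <- E2.
    rewrite (Cmult_comm (csum _ _)), <- csum_scal.
    assert (Ad : forall u v m, csum (fun i => u i + v i)%C m = (csum u m + csum v m)%C).
    { intros u v m; induction m as [|m IHm]; simpl; [ring | rewrite IHm; ring]. }
    rewrite <- Cplus_assoc, <- Ad. f_equal. apply csum_ext; intros i _.
    simpl qcoef. rewrite Cpow_S, RtoC_plus, RtoC_mult. ring.
Qed.

(** The quotient of consecutive terms of the q-binomial theorem, p^j (1 - p^(n-j)) / (1 - p^(j+1)),
    cleared of denominators; in this form it also covers [j >= n]. *)
Lemma qcoef_ratio (p : R) (n j : nat) :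
  qcoef p n (S j) * (1 - p ^ S j) = qcoef p n j * (p ^ j - p ^ n).
Proof.
  revert j; induction n as [|n IH]; intros j.
  - destruct j; simpl; ring.
  - destruct j as [|j].
    + generalize (IH O); simpl. intros H.
      transitivity (qcoef p n 1 * (1 - p * 1) + p ^ n * qcoef p n 0 * (1 - p)); [ring|].
      rewrite H; ring.
    + generalize (IH (S j)) (IH j).
      change (qcoef p (S n) (S (S j)))
        with (qcoef p n (S (S j)) + p ^ n * qcoef p n (S j)).
      change (qcoef p (S n) (S j)) with (qcoef p n (S j) + p ^ n * qcoef p n j).
      intros H1 H2. rewrite Rmult_plus_distr_r, H1.
      transitivity (qcoef p n (S j) * (p ^ S j - p ^ n) + p ^ n * qcoef p n (S j)
        * (1 - p ^ S (S j)) + p * p ^ n * (qcoef p n j * (p ^ j - p ^ n)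
           - qcoef p n (S j) * (1 - p ^ S j))); [rewrite H2; ring|].
      simpl; ring.
Qed.

Lemma qcoef_ge0 (p : R) (n j : nat) : 0 <= p -> 0 <= qcoef p n j.
Proof.
  intros Hp; revert j; induction n as [|n IH]; intros [|j]; simpl; try lra; auto.
  apply Rplus_le_le_0_compat; [auto|]. apply Rmult_le_pos; [apply pow_le|]; auto.
Qed.

Lemma qcoef_gt0 (p : R) (n j : nat) : 0 < p -> (j <= n)%nat -> 0 < qcoef p n j.
Proof.
  intros Hp; revert j; induction n as [|n IH]; intros [|j] Hj; simpl; try lra; try lia.
  - apply IH; lia.
  - assert (0 < p ^ n * qcoef p n j) by (apply Rmult_lt_0_compat;
      [apply pow_lt; easy | apply IH; lia]).
    generalize (qcoef_ge0 p n (S j) (Rlt_le _ _ Hp)); lra.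
Qed.

(** The product of [1 + p^l w] over 1 <= l <= m, one of the two outer factors of the triple
    product. *)
Definition qhalf (p : R) (m : nat) (w : C) : C := qprod p m (RtoC p * w)%C.

Lemma qhalf_S (p : R) (m : nat) (w : C) :
  qhalf p (S m) w = (qhalf p m w * (1 + RtoC (p ^ S m) * w))%C.
Proof. unfold qhalf; simpl. rewrite !RtoC_mult. ring. Qed.

Lemma qprod_shift (p : R) (n : nat) (x : C) :
  qprod p (S n) x = ((1 + x) * qprod p n (RtoC p * x))%C.
Proof.
  induction n as [|n IH]; [simpl; ring|].
  change (qprod p (S (S n)) x) with (qprod p (S n) x * (1 + RtoC (p ^ S n) * x))%C.
  rewrite IH. simpl. rewrite !RtoC_mult. ring.
Qed.

(** The 2m+1 factors are [1 + p^l w] for -m <= l <= m. Each one of negative index is turned over,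
    [1 + p^(-j) w = p^(-j) w (1 + p^j v)]; the extracted monomials make up [K * w^m]. *)
Lemma triple_product (p : R) (m : nat) : 0 < p ->
  exists K, 0 < K /\ forall w v : C, (w * v = 1)%C ->
    (qprod p (2 * m + 1) (RtoC (/ p ^ m) * w)
     = RtoC K * w ^ m * ((1 + w) * qhalf p m w * qhalf p m v))%C.
Proof.
  intros Hp. assert (Hpp : forall i, p ^ i <> 0) by (intro; apply pow_nonzero; lra).
  assert (Hpc : forall i, RtoC (p ^ i) <> 0%C)
    by (intros i H; apply RtoC_inj in H; apply (Hpp i H)).
  induction m as [|m [K [HK IH]]].
  - exists 1; split; [lra|]. intros w v _. unfold qhalf; simpl.
    rewrite Rinv_1. ring.
  - exists (K / p ^ S m); split; [apply Rdiv_lt_0_compat; auto using pow_lt|].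
    intros w v H.
    replace (2 * S m + 1)%nat with (S (S (2 * m + 1))) by lia.
    rewrite qprod_shift.
    replace (RtoC p * (RtoC (/ p ^ S m) * w))%C with (RtoC (/ p ^ m) * w)%C.
    2: { rewrite Cmult_assoc, <- RtoC_mult. do 2 f_equal. simpl; field.
         split; [auto | lra]. }
    change (qprod p (S (2 * m + 1)) ?x)
      with (qprod p (2 * m + 1) x * (1 + RtoC (p ^ (2 * m + 1)) * x))%C.
    rewrite (IH w v H), !qhalf_S.
    replace (RtoC (p ^ (2 * m + 1)) * (RtoC (/ p ^ m) * w))%C
      with (RtoC (p ^ S m) * w)%C.
    2: { rewrite Cmult_assoc, <- RtoC_mult. do 2 f_equal.
         replace (2 * m + 1)%nat with (m + S m)%nat by lia. rewrite pow_add.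
         field; auto. }
    rewrite Cpow_S, RtoC_div, RtoC_inv by auto.
    replace (1 + / RtoC (p ^ S m) * w)%C
      with (/ RtoC (p ^ S m) * w * (1 + RtoC (p ^ S m) * v))%C; [unfold Cdiv; ring|].
    transitivity (/ RtoC (p ^ S m) * w
      + / RtoC (p ^ S m) * RtoC (p ^ S m) * (w * v))%C; [ring|].
    rewrite H, Cinv_l by auto. ring.
Qed.

(** With [s = rho * p] one has s^2 <= p <= 4/9, so the first factor is at least 1 - s >= 1/3. The
    others multiply to at least 1 - s * (p + p^2 + ...) >= 1 - 4/9, which gives 5/27. *)
Lemma qhalf_lower (p rho : R) (m : nat) (w : C) :
  0 < p <= 2 / 5 -> Cmod w <= rho -> 1 <= rho -> p * rho ^ 2 <= 1 ->
  5 / 27 <= Cmod (qhalf p m w).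
Proof.
  intros Hp Hw Hrho Hpr.
  set (s := rho * p). assert (Hs : 0 <= s <= 2 / 3).
  { split; [unfold s; nra|]. assert (s ^ 2 <= 4 / 9); [unfold s; nra | nra]. }
  assert (F : forall l, 1 - s * p ^ l <= Cmod (1 + RtoC (p ^ S l) * w)).
  { intros l. generalize (Cmod_triangle (1 + RtoC (p ^ S l) * w) (- (RtoC (p ^ S l) * w))).
    replace (1 + RtoC (p ^ S l) * w + - (RtoC (p ^ S l) * w))%C with (RtoC 1) by ring.
    assert (0 < p ^ S l) by (apply pow_lt; lra).
    rewrite Cmod_1, Cmod_opp, Cmod_mult, Cmod_R, Rabs_pos_eq by lra.
    assert (p ^ S l * Cmod w <= s * p ^ l); [|lra].
    replace (s * p ^ l) with (p ^ S l * rho) by (unfold s; simpl; ring).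
    apply Rmult_le_compat_l; lra. }
  clearbody s.
  (* The partial geometric sum is (p - p^(m+1)) / (1 - p), and 5/3 bounds 1 / (1 - p). *)
  assert (I : forall m, (1 - s) * (1 - s * (5 / 3) * (p - p ^ S m)) <= Cmod (qhalf p (S m) w)).
  { intros n; induction n as [|n IH].
    - rewrite qhalf_S, Cmod_mult. unfold qhalf; simpl qprod. rewrite Cmod_1.
      generalize (F O); simpl; nra.
    - rewrite qhalf_S, Cmod_mult.
      assert (P : 0 < p ^ S n <= p).
      { split; [apply pow_lt; lra|]. simpl. assert (p ^ n <= 1); [|nra].
        rewrite <- (pow1 n); apply pow_incr; lra. }
      generalize (F (S n)); intros F1.
      apply Rle_trans with ((1 - s) * (1 - s * (5 / 3) * (p - p ^ S n)) * (1 - s * p ^ S n)).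
      + change (p ^ S (S n)) with (p * p ^ S n). set (t := p ^ S n) in *; clearbody t.
        assert (0 <= s * (5 / 3) * (p - t) * (s * t)) by (repeat apply Rmult_le_pos; lra).
        assert (0 <= s * t * (2 / 3 - 5 / 3 * p)) by (repeat apply Rmult_le_pos; lra).
        rewrite (Rmult_assoc (1 - s) _ (1 - s * t)). apply Rmult_le_compat_l; nra.
      + assert (0 <= s * (p - p ^ S n) <= 2 / 3 * (2 / 5))
          by (split; [apply Rmult_le_pos | apply Rmult_le_compat]; lra).
        assert (0 <= s * p ^ S n <= 2 / 3 * (2 / 5))
          by (split; [apply Rmult_le_pos | apply Rmult_le_compat]; lra).
        apply Rmult_le_compat; try lra.
        apply Rmult_le_pos; lra. }
  destruct m as [|m].
  { unfold qhalf; simpl; rewrite Cmod_1; lra. }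
  eapply Rle_trans; [|apply I].
  assert (P : 0 < p ^ S m) by (apply pow_lt; lra).
  assert (s * (5 / 3) * (p - p ^ S m) <= 4 / 9) by nra. nra.
Qed.

Lemma qhalf_1_upper (p : R) (m : nat) : 0 < p <= 2 / 5 -> Cmod (qhalf p m 1) <= 3.
Proof.
  intros Hp.
  (* The slack [2 * p^m] pays for the next factor; the induction step amounts to 5 p <= 2. *)
  assert (I : Cmod (qhalf p m 1) <= 3 - 2 * p ^ m).
  { induction m as [|m IH]; [unfold qhalf; simpl; rewrite Cmod_1; lra|].
    rewrite qhalf_S, Cmod_mult, Cmult_1_r, <- RtoC_plus, Cmod_R.
    assert (P : 0 < p ^ m <= 1).
    { split; [apply pow_lt; lra|]. rewrite <- (pow1 m); apply pow_incr; lra. }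
    simpl. rewrite Rabs_pos_eq by nra.
    apply Rle_trans with ((3 - 2 * p ^ m) * (1 + p * p ^ m)).
    - apply Rmult_le_compat_r; [nra|easy].
    - set (t := p ^ m) in *; clearbody t.
      assert (0 <= t * (2 - 5 * p)) by (apply Rmult_le_pos; lra).
      assert (0 <= p * t * t) by (repeat apply Rmult_le_pos; lra). nra. }
  assert (0 < p ^ m) by (apply pow_lt; lra). lra.
Qed.

Lemma theta_pos_dominated (p rho : R) :
  0 <= p <= 2 / 5 -> 1 <= rho -> p * rho ^ 2 <= 1 -> dominated (theta_pos p) rho.
Proof.
  intros Hp Hrho Hpr i. unfold theta_pos.
  split; [apply pow_le; lra|]. simpl tri.
  rewrite pow_add, Rmult_assoc, <- Rpow_mult_distr.
  assert (0 <= p * rho <= 1) by (split; nra).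
  assert ((p * rho) ^ i <= 1) by (rewrite <- (pow1 i); apply pow_incr; easy).
  assert (p ^ tri i <= (/ 2) ^ tri i) by (apply pow_incr; lra).
  assert (0 <= p ^ tri i) by (apply pow_le; lra).
  assert (0 <= (p * rho) ^ i) by (apply pow_le; lra). nra.
Qed.

Lemma theta_neg_dominated (p rho : R) :
  0 <= p <= 2 / 5 -> 1 <= rho -> p * rho ^ 2 <= 1 -> dominated' (theta_neg p) rho.
Proof.
  intros Hp Hrho Hpr i.
  destruct (theta_pos_dominated p rho Hp Hrho Hpr i) as [H1 H2].
  destruct i as [|i]; [simpl; lra|]. easy.
Qed.

Lemma dominated_le (al al' : nat -> R) (r : R) : 0 <= r ->
  (forall i, 0 <= al (S i) <= al' (S i)) -> dominated al' r -> dominated al r.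
Proof.
  intros Hr H D i. destruct (D i) as [_ D2], (H i) as [H1 H2]. split; [easy|].
  eapply Rle_trans; [|apply D2]. apply Rmult_le_compat_r; [apply pow_le|]; easy.
Qed.

Lemma dominated'_le (be be' : nat -> R) (r : R) : 0 <= r ->
  (forall i, 0 <= be i <= be' i) -> dominated' be' r -> dominated' be r.
Proof.
  intros Hr H D i. destruct (D i) as [_ D2], (H i) as [H1 H2]. split; [easy|].
  eapply Rle_trans; [|apply D2]. apply Rmult_le_compat_r; [apply pow_le|]; easy.
Qed.

Lemma csum_RtoC (u : nat -> R) (n : nat) :
  csum (fun i => RtoC (u i)) n = RtoC (rsum u n).
Proof. induction n as [|n IH]; simpl; [easy | rewrite IH, RtoC_plus; easy]. Qed.

Lemma is_lim_seq_pow_shift (p : R) (j : nat) : 0 <= p < 1 ->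
  is_lim_seq (fun m => p ^ (m + j)) 0.
Proof.
  intros Hp. apply (is_lim_seq_incr_n (fun m => p ^ m) j).
  apply is_lim_seq_geom. rewrite Rabs_pos_eq; lra.
Qed.

(** Coefficients of the finite triple product of order [m], normalised by the central one. *)
Definition qpos (p : R) (m : nat) : nat -> R := coef_pos (qcoef p (2 * m + 1)) m (/ p ^ m).
Definition qneg (p : R) (m : nat) : nat -> R := coef_neg (qcoef p (2 * m + 1)) m (/ p ^ m).

(** * Convergence of the finite triple products to the theta series *)

Section FiniteTheta.
Variable p : R.
Hypothesis Hp : 0 < p <= 2 / 5.

Let pow_pos i : 0 < p ^ i.
Proof. apply pow_lt; lra. Qed.

Let pow_lt1 i : p ^ S i < 1.
Proof.
  apply Rle_lt_trans with p; [|lra]. simpl.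
  assert (p ^ i <= 1) by (rewrite <- (pow1 i); apply pow_incr; lra). nra.
Qed.

Let mid_pos m : 0 < qcoef p (2 * m + 1) m.
Proof. apply qcoef_gt0; [lra|lia]. Qed.

Lemma qpos_0 (m : nat) : qpos p m 0 = 1.
Proof.
  unfold qpos, coef_pos. rewrite Nat.add_0_r, pow_O.
  generalize (mid_pos m); intros; field; lra.
Qed.

Lemma qpos_S (m i : nat) :
  qpos p m (S i) = qpos p m i * ((p ^ i - p ^ (m + 1)) / (1 - p ^ S (m + i))).
Proof.
  assert (E := qcoef_ratio p (2 * m + 1) (m + i)).
  generalize (pow_lt1 (m + i)) (mid_pos m) (pow_pos m); intros.
  unfold qpos, coef_pos. rewrite (Nat.add_succ_r m i).
  apply Rmult_eq_reg_r with (1 - p ^ S (m + i)); [|lra].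
  transitivity (qcoef p (2 * m + 1) (S (m + i)) * (1 - p ^ S (m + i))
    / qcoef p (2 * m + 1) m * (/ p ^ m) ^ S i); [field; lra|].
  rewrite E. replace (2 * m + 1)%nat with (m + (m + 1))%nat at 2 by lia.
  rewrite !(pow_add p m). simpl ((/ p ^ m) ^ S i). field. lra.
Qed.

(** Each quotient in [qpos_S] is at most [p^i], since [p^(m+1) * p^(2i) <= p^(m+1)]. The theta
    coefficients thus serve as a majorant for all [m] at once. *)
Lemma qpos_bounds (m i : nat) : 0 <= qpos p m i <= theta_pos p i.
Proof.
  induction i as [|i IH].
  - rewrite qpos_0; unfold theta_pos; simpl; lra.
  - split.
    { unfold qpos, coef_pos, Rdiv. apply Rmult_le_pos; [apply Rmult_le_pos|].
      - apply qcoef_ge0; lra.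
      - left; apply Rinv_0_lt_compat, mid_pos.
      - apply pow_le; left; apply Rinv_0_lt_compat, pow_pos. }
    unfold theta_pos. simpl tri. rewrite qpos_S, (pow_add p (tri i)).
    assert (L : (p ^ i - p ^ (m + 1)) / (1 - p ^ S (m + i)) <= p ^ i).
    { generalize (pow_lt1 (m + i)); intros.
      apply Rle_div_l; [lra|].
      replace (S (m + i)) with ((m + 1) + i)%nat by lia. rewrite (pow_add p (m + 1)).
      generalize (pow_pos (m + 1)) (pow_pos i); intros.
      assert (p ^ i <= 1) by (rewrite <- (pow1 i); apply pow_incr; lra).
      assert (0 <= p ^ (m + 1) * (1 - p ^ i * p ^ i)) by (apply Rmult_le_pos; nra).
      nra. }
    apply Rle_trans with (qpos p m i * p ^ i).
    + apply Rmult_le_compat_l; [apply IH | exact L].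
    + apply Rmult_le_compat_r; [left; apply pow_pos | apply IH].
Qed.

Lemma qpos_lim (i : nat) : is_lim_seq (fun m => qpos p m i) (theta_pos p i).
Proof.
  induction i as [|i IH].
  - eapply is_lim_seq_ext; [intros m; symmetry; apply qpos_0|].
    unfold theta_pos; simpl; apply is_lim_seq_const.
  - eapply is_lim_seq_ext; [intros m; symmetry; apply qpos_S|].
    replace (Finite (theta_pos p (S i)))
      with (Finite (theta_pos p i * ((p ^ i - 0) / (1 - 0)))).
    2: { f_equal; unfold theta_pos; simpl tri; rewrite pow_add; field. }
    apply is_lim_seq_mult'; [easy|]. apply is_lim_seq_div'; [| |lra].
    + apply is_lim_seq_minus'; [apply is_lim_seq_const|].
      apply is_lim_seq_pow_shift; lra.
    + apply is_lim_seq_minus'; [apply is_lim_seq_const|].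
      eapply is_lim_seq_ext; [|apply (is_lim_seq_pow_shift p (S i)); lra].
      intros m; cbv beta; f_equal; lia.
Qed.

(** [qneg] without its guard and with value 1 at index 0, so that a recursion in [i] can start
    there; used only for [i <= m]. *)
Let qlow (m i : nat) : R :=
  qcoef p (2 * m + 1) (m - i) / qcoef p (2 * m + 1) m / (/ p ^ m) ^ i.

Let qlow_0 m : qlow m 0 = 1.
Proof.
  unfold qlow. rewrite Nat.sub_0_r, pow_O. generalize (mid_pos m); intros. field; lra.
Qed.

Let qlow_S (m i : nat) : (S i <= m)%nat ->
  qlow m (S i) = qlow m i * (p ^ S i * (1 - p ^ (m - i)) / (1 - p ^ S (S (m + i)))).
Proof.
  intros Hi. assert (E := qcoef_ratio p (2 * m + 1) (m - S i)).
  generalize (pow_lt1 (S (m + i))) (mid_pos m) (pow_pos m) (pow_pos (m - S i))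
    (pow_pos (S i)); intros.
  unfold qlow.
  replace (S (m - S i)) with (m - i)%nat in E by lia.
  replace (2 * m + 1)%nat with ((m - S i) + S (S (m + i)))%nat in E at 3 by lia.
  rewrite pow_add in E.
  apply Rmult_eq_reg_r with ((1 - p ^ S (S (m + i))) * p ^ (m - S i) * (/ p ^ m) ^ i).
  2: { repeat apply Rmult_integral_contrapositive_currified; try lra.
       apply pow_nonzero, Rinv_neq_0_compat; lra. }
  assert (Hr : (/ p ^ m) ^ i <> 0) by (apply pow_nonzero, Rinv_neq_0_compat; lra).
  transitivity (qcoef p (2 * m + 1) (m - S i)
    * (p ^ (m - S i) - p ^ (m - S i) * p ^ S (S (m + i)))
    / qcoef p (2 * m + 1) m * p ^ m).
  { simpl ((/ p ^ m) ^ S i). field. lra. }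
  rewrite <- E.
  replace (p ^ m) with (p ^ (m - S i) * p ^ S i) at 1
    by (rewrite <- pow_add; f_equal; lia).
  field. lra.
Qed.

Let qlow_nonneg m i : 0 <= qlow m i.
Proof.
  unfold qlow, Rdiv. apply Rmult_le_pos; [apply Rmult_le_pos|].
  - apply qcoef_ge0; lra.
  - left; apply Rinv_0_lt_compat, mid_pos.
  - left; apply Rinv_0_lt_compat, pow_lt, Rinv_0_lt_compat, pow_pos.
Qed.

Let qlow_bound m i : (i <= m)%nat -> qlow m i <= p ^ tri (S i).
Proof.
  induction i as [|i IH]; intros Hi.
  - rewrite qlow_0; simpl; lra.
  - rewrite qlow_S by easy. change (tri (S (S i))) with (tri (S i) + S i)%nat.
    rewrite pow_add.
    assert (L : p ^ S i * (1 - p ^ (m - i)) / (1 - p ^ S (S (m + i))) <= p ^ S i).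
    { generalize (pow_lt1 (S (m + i))); intros.
      apply Rle_div_l; [lra|].
      replace (S (S (m + i))) with ((m - i) + (S i + S i))%nat by lia.
      rewrite (pow_add p (m - i)).
      generalize (pow_pos (m - i)) (pow_pos (S i)); intros.
      assert (p ^ (S i + S i) <= 1) by (rewrite <- (pow1 (S i + S i)); apply pow_incr; lra).
      assert (0 <= p ^ S i * (p ^ (m - i) * (1 - p ^ (S i + S i))))
        by (apply Rmult_le_pos; [lra | apply Rmult_le_pos; lra]).
      lra. }
    apply Rle_trans with (qlow m i * p ^ S i).
    + apply Rmult_le_compat_l; [apply qlow_nonneg | exact L].
    + apply Rmult_le_compat_r; [left; apply pow_pos | apply IH; lia].
Qed.

Let qlow_lim i : is_lim_seq (fun m => qlow m i) (p ^ tri (S i)).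
Proof.
  induction i as [|i IH].
  - eapply is_lim_seq_ext; [intros m; symmetry; apply qlow_0|].
    simpl; apply is_lim_seq_const.
  - eapply is_lim_seq_ext_loc;
      [exists (S i); intros m Hm; symmetry; apply qlow_S; easy|].
    replace (Finite (p ^ tri (S (S i))))
      with (Finite (p ^ tri (S i) * (p ^ S i * (1 - 0) / (1 - 0)))).
    2: { f_equal. change (tri (S (S i))) with (tri (S i) + S i)%nat.
         rewrite pow_add; field. }
    apply is_lim_seq_mult'; [easy|]. apply is_lim_seq_div'; [| |lra].
    + apply is_lim_seq_mult'; [apply is_lim_seq_const|].
      apply is_lim_seq_minus'; [apply is_lim_seq_const|].
      apply (is_lim_seq_incr_n (fun m => p ^ (m - i)) i).
      eapply is_lim_seq_ext; [|apply (is_lim_seq_pow_shift p 0); lra].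
      intros m; cbv beta; f_equal; lia.
    + apply is_lim_seq_minus'; [apply is_lim_seq_const|].
      eapply is_lim_seq_ext; [|apply (is_lim_seq_pow_shift p (S (S i))); lra].
      intros m; cbv beta; f_equal; lia.
Qed.

Lemma qneg_bounds (m i : nat) : 0 <= qneg p m i <= theta_neg p i.
Proof.
  destruct i as [|i]; [simpl; lra|].
  unfold qneg, coef_neg. destruct (Nat.leb_spec (S i) m) as [H|H].
  - split; [apply (qlow_nonneg m (S i)) | apply (qlow_bound m (S i) H)].
  - split; [lra|]. left; apply pow_pos.
Qed.

Lemma qneg_lim (i : nat) : is_lim_seq (fun m => qneg p m i) (theta_neg p i).
Proof.
  destruct i as [|i]; [apply is_lim_seq_const|].
  eapply is_lim_seq_ext_loc; [|apply (qlow_lim (S i))].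
  exists (S i); intros m Hm. unfold qneg, coef_neg.
  destruct (Nat.leb_spec (S i) m); [easy|lia].
Qed.

(** The constant is bounded without being computed, by evaluation at [w = v = 1]: the Laurent side
    has nonnegative coefficients and constant term 1, the product side is [c] times 2 times the
    square of a number at most 3. *)
Lemma finite_theta_product (m : nat) : exists c, / 18 <= c /\
  forall N w v, (w * v = 1)%C -> (m + 1 < N)%nat ->
  laurent (qpos p m) (qneg p m) N w v
  = (RtoC c * ((1 + w) * qhalf p m w * qhalf p m v))%C.
Proof.
  destruct (triple_product p m (proj1 Hp)) as [K [HK HT]].
  set (d := qcoef p (2 * m + 1)). set (r := / p ^ m) in *.
  assert (Hr : 0 < r) by (apply Rinv_0_lt_compat, pow_pos).
  assert (Hd : 0 < d m) by apply mid_pos.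
  assert (Hrm : 0 < r ^ m) by (apply pow_lt; easy).
  set (c := K / (d m * r ^ m)).
  assert (E : forall N w v, (w * v = 1)%C -> (m + 1 < N)%nat ->
    laurent (qpos p m) (qneg p m) N w v
    = (RtoC c * ((1 + w) * qhalf p m w * qhalf p m v))%C).
  { intros N w v Hwv HN.
    assert (R := laurent_recentre d m N r w v ltac:(lra) Hr Hwv ltac:(lia)).
    unfold d at 1 in R. rewrite qprod_expand, (HT w v Hwv), Cpow_mult_l in R by lia.
    assert (Hw : w <> 0%C).
    { intros H; rewrite H, Cmult_0_l in Hwv. apply RtoC_inj in Hwv; lra. }
    assert (Hwm : (w ^ m <> 0)%C) by (apply Cpow_nz; easy).
    assert (Hdc : RtoC (d m) <> 0%C) by (intros H; apply RtoC_inj in H; lra).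
    assert (Hrc : RtoC (r ^ m) <> 0%C) by (intros H; apply RtoC_inj in H; lra).
    unfold c. rewrite RtoC_div, RtoC_mult
      by (apply Rmult_integral_contrapositive_currified; lra).
    rewrite <- RtoC_pow in R. fold d r in R |- *.
    change (qpos p m) with (coef_pos d m r). change (qneg p m) with (coef_neg d m r).
    set (X := laurent _ _ _ _ _) in *. set (Y := ((1 + w) * qhalf p m w * qhalf p m v)%C) in *.
    transitivity ((RtoC K * w ^ m * Y) / (RtoC (d m) * RtoC (r ^ m) * w ^ m))%C;
      [rewrite R|]; field; auto. }
  exists c; split; [|exact E].
  assert (E1 := E (S (S m) ) 1%C 1%C ltac:(ring) ltac:(lia)).
  assert (Hc : 0 < c) by (apply Rdiv_lt_0_compat; [|apply Rmult_lt_0_compat]; easy).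
  assert (L : 1 <= Cmod (laurent (qpos p m) (qneg p m) (S (S m)) 1 1)).
  { unfold laurent.
    rewrite (csum_ext _ (fun i => RtoC (qpos p m i)))
      by (intros; rewrite Cpow_1_l; ring).
    rewrite (csum_ext (fun i => RtoC (qneg p m i) * 1 ^ i)%C (fun i => RtoC (qneg p m i)))
      by (intros; rewrite Cpow_1_l; ring).
    rewrite !csum_RtoC, <- RtoC_plus, Cmod_R.
    change (S (S m)) with (1 + S m)%nat at 1. rewrite rsum_app.
    generalize (rsum_ge0 (fun i => qpos p m (1 + i)) (S m)
                  (fun i _ => proj1 (qpos_bounds m (1 + i))))
      (rsum_ge0 (qneg p m) (S (S m)) (fun i _ => proj1 (qneg_bounds m i))).
    assert (Q1 : rsum (qpos p m) 1 = 1) by (simpl; rewrite qpos_0; ring).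
    rewrite Q1. intros. eapply Rle_trans; [|apply Rle_abs]. lra. }
  rewrite E1, !Cmod_mult, Cmod_R, (Rabs_pos_eq c) in L by lra.
  rewrite <- RtoC_plus, Cmod_R, Rabs_pos_eq in L by lra.
  generalize (qhalf_1_upper p m Hp) (Cmod_ge_0 (qhalf p m 1)); intros U U0.
  assert (Cmod (qhalf p m 1) * Cmod (qhalf p m 1) <= 9) by nra.
  apply Rmult_le_reg_r with 18; [lra|]. rewrite Rinv_l by lra. nra.
Qed.

End FiniteTheta.

Lemma sqrt_annulus (p : R) (w : C) : 0 < p -> p * Cmod w ^ 2 <= 1 -> Cmod w <= sqrt (/ p).
Proof.
  intros Hp H. rewrite <- (sqrt_pow2 (Cmod w)) by apply Cmod_ge_0.
  apply sqrt_le_1_alt. apply Rmult_le_reg_l with p; [easy|]. rewrite Rinv_r; lra.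
Qed.

(** The finite triple products satisfy this bound uniformly and their coefficients converge
    to those of the theta function. *)
Lemma theta_lower (p : R) : 0 <= p <= 2 / 5 -> exists s, 0 < s /\
  exists N0, forall N w v, (N0 <= N)%nat -> (w * v = 1)%C -> w <> (-(1))%C ->
  p * Cmod w ^ 2 <= 1 -> p * Cmod v ^ 2 <= 1 ->
  s <= Cmod (laurent_dd (theta_pos p) (theta_neg p) N w v (-(1)) (-(1))).
Proof.
  intros [[Hp|<-] Hp1].
  (* For [p = 0], with 0^0 = 1, the series is [1 + w] and its divided difference is 1. *)
  2: { exists 1; split; [lra|]. exists 2%nat. intros N w v HN _ _ _ _.
    unfold laurent_dd. replace N with (2 + (N - 2))%nat by lia. rewrite !csum_app.
    rewrite (csum_0 (fun i => _ * divdiff (2 + i) w _)%C).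
    2: { intros; unfold theta_pos; simpl tri.
         rewrite Nat.add_succ_r; simpl; rewrite Rmult_0_l; ring. }
    rewrite (csum_0 (fun i => _ * divdiff (2 + i) v _)%C).
    2: { intros; unfold theta_neg; simpl tri.
         rewrite Nat.add_succ_r; simpl; rewrite Rmult_0_l; ring. }
    match goal with |- 1 <= Cmod ?x => replace x with (RtoC 1) end;
      [rewrite Cmod_1; lra|].
    unfold theta_pos, theta_neg; simpl. rewrite Rmult_0_l. ring. }
  set (rho := sqrt (/ p)).
  assert (Hrho : 1 <= rho).
  { rewrite <- sqrt_1. apply sqrt_le_1_alt. rewrite <- Rinv_1. apply Rinv_le_contravar; lra. }
  assert (Hpr : p * rho ^ 2 <= 1).
  { unfold rho. rewrite pow2_sqrt by (left; apply Rinv_0_lt_compat; easy).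
    rewrite Rinv_r; lra. }
  assert (Hp' : 0 < p <= 2 / 5) by lra. assert (Hp'' : 0 <= p <= 2 / 5) by lra.
  (* The bound of [finite_theta_product] times that of [qhalf_lower] for [w] and for [v]; half of it
     is given up in passing from the product to theta. *)
  set (s := / 18 * (5 / 27) * (5 / 27)).
  assert (Hs : 0 < s) by (unfold s; lra).
  exists (s / 2); split; [lra|].
  (* The running index is the order of the product. A single order [m] is fixed, good for every
     number [N] of terms. *)
  destruct (laurent_limit (qpos p) (qneg p) (fun _ => theta_pos p) (fun _ => theta_neg p)
    (fun _ => rho) (fun _ => rho)) with (eps := s / 2) as [m Hm]; try easy; try lra.
  { exists O; intros k _. assert (D := theta_pos_dominated p rho Hp'' Hrho Hpr).
    assert (D' := theta_neg_dominated p rho Hp'' Hrho Hpr).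
    refine (conj _ (conj D (conj _ D'))).
    - apply (dominated_le _ (theta_pos p));
        [lra | intros i; apply qpos_bounds; easy | easy].
    - apply (dominated'_le _ (theta_neg p));
        [lra | intros i; apply qneg_bounds; easy | easy]. }
  1, 2: intros i;
    replace (Finite 0) with (Rbar_mult (Finite 0) (Finite (rho ^ i)))
      by (simpl; f_equal; ring);
    apply is_lim_seq_scal_r.
  { replace (Finite 0) with (Finite (theta_pos p (S i) - theta_pos p (S i)))
      by (f_equal; ring).
    apply is_lim_seq_minus'; [apply qpos_lim; easy | apply is_lim_seq_const]. }
  { replace (Finite 0) with (Finite (theta_neg p i - theta_neg p i))
      by (f_equal; ring).
    apply is_lim_seq_minus'; [apply qneg_lim; easy | apply is_lim_seq_const]. }
  exists (m + 2)%nat; intros N w v HN Hwv Hw1 Hw Hv.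
  apply sqrt_annulus in Hw, Hv; try easy. fold rho in Hw, Hv.
  destruct (finite_theta_product p Hp' m) as [c [Hc E]].
  assert (Dif := laurent_diff (qpos p m) (qneg p m) N w v (-(1)) (-(1)) Hwv ltac:(ring)).
  rewrite (E N w v Hwv ltac:(lia)), (E N (-(1))%C (-(1))%C ltac:(ring) ltac:(lia)) in Dif.
  set (DQ := laurent_dd (qpos p m) (qneg p m) N w v (- (1)) (- (1))) in *.
  assert (Hne : 0 < Cmod (1 + w)).
  { apply Cmod_gt_0. intros H. apply Hw1.
    transitivity (1 + w - 1)%C; [ring | rewrite H; ring]. }
  (* The product vanishes at -1, so the divided difference with that node is the product without its
     factor [1 + w]. *)
  assert (DQE : DQ = (RtoC c * (qhalf p m w * qhalf p m v))%C).
  { assert (N1 : (1 + w <> 0)%C) by (apply Cmod_gt_0; easy).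
    transitivity ((w - - (1)) * DQ / (1 + w))%C; [field; easy|].
    rewrite <- Dif. field; easy. }
  assert (LQ : s <= Cmod DQ).
  { rewrite DQE, !Cmod_mult, Cmod_R, Rabs_pos_eq by lra.
    generalize (qhalf_lower p rho m w Hp' Hw Hrho Hpr)
      (qhalf_lower p rho m v Hp' Hv Hrho Hpr); intros.
    unfold s. rewrite Rmult_assoc.
    repeat apply Rmult_le_compat; lra. }
  assert (C := laurent_dd_compare (qpos p m) (qneg p m) (theta_pos p) (theta_neg p)
    N w v rho rho Hrho Hrho Hw Hv).
  specialize (Hm m N (le_n _)). fold DQ in C.
  set (DT := laurent_dd (theta_pos p) _ _ _ _ _ _) in *.
  assert (T := Cmod_triangle (DQ - DT) DT).
  replace (DQ - DT + DT)%C with DQ in T by ring. lra.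
Qed.

(** * Zeros far from the origin *)

(** Carries a lower bound for the divided difference with node -1 over to any two nodes close to
    -1. *)
Lemma laurent_dd_lipschitz : exists K0, 0 < K0 /\
  forall al be N w1 w2 w3 w4 v1 v2 v3 v4,
  (forall i, 0 <= al (S i) <= (/ 2) ^ tri i) -> (forall i, 0 <= be i <= (/ 2) ^ tri i) ->
  (w1 * v1 = 1)%C -> (w2 * v2 = 1)%C -> (w3 * v3 = 1)%C -> (w4 * v4 = 1)%C ->
  Cmod w1 <= 2 -> Cmod w2 <= 2 -> Cmod w3 <= 2 -> Cmod w4 <= 2 ->
  Cmod v1 <= 2 -> Cmod v2 <= 2 -> Cmod v3 <= 2 -> Cmod v4 <= 2 ->
  Cmod (laurent_dd al be N w1 v1 w2 v2 - laurent_dd al be N w3 v3 w4 v4)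
    <= K0 * (Cmod (w1 - w3) + Cmod (w2 - w4)).
Proof.
  destruct tri_decay as [M [HM Hdec]].
  (* The positive side costs [8 * M], the variation of the negative sum [4 * 8 * M], that of its
     prefactor [8 * 2 * M]; the 1 ensures positivity. *)
  exists (56 * M + 1); split; [lra|].
  intros al be N w1 w2 w3 w4 v1 v2 v3 v4 Hal Hbe E1 E2 E3 E4 W1 W2 W3 W4 V1 V2 V3 V4.
  assert (Inv : forall w v w' v' : C, (w * v = 1)%C -> (w' * v' = 1)%C ->
    Cmod v <= 2 -> Cmod v' <= 2 -> Cmod (v - v') <= 4 * Cmod (w - w')).
  { intros w v w' v' E E' Hv Hv'.
    assert (H : (v - v' = - (w - w') * (v * v'))%C).
    { transitivity ((w' * v') * v - (w * v) * v')%C; [rewrite E, E'; ring | ring]. }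
    rewrite H, Cmod_mult, Cmod_opp, Cmod_mult.
    generalize (Cmod_ge_0 v) (Cmod_ge_0 v') (Cmod_ge_0 (w - w')); intros.
    assert (Cmod v * Cmod v' <= 4) by nra. nra. }
  assert (I13 := Inv _ _ _ _ E1 E3 V1 V3). assert (I24 := Inv _ _ _ _ E2 E4 V2 V4).
  set (d := Cmod (w1 - w3) + Cmod (w2 - w4)).
  assert (Hd : 0 <= d) by (apply Rplus_le_le_0_compat; apply Cmod_ge_0).
  assert (A : Cmod (csum (fun i => RtoC (al i) * divdiff i w1 w2)%C N
    - csum (fun i => RtoC (al i) * divdiff i w3 w4)%C N) <= 2 * (4 * M * d)).
  { rewrite <- csum_minus.
    eapply Rle_trans; [|apply rsum_geom_half; nra].
    apply Cmod_csum_le; intros i _.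
    replace (RtoC (al i) * divdiff i w1 w2 - RtoC (al i) * divdiff i w3 w4)%C
      with (RtoC (al i) * (divdiff i w1 w2 - divdiff i w3 w4))%C by ring.
    rewrite Cmod_mult, Cmod_R.
    assert (L := divdiff_lipschitz i w1 w2 w3 w4 2 ltac:(lra) W1 W2 W3 W4). fold d in L.
    destruct i as [|i].
    { replace (divdiff 0 w1 w2 - divdiff 0 w3 w4)%C with (RtoC 0) by (simpl; ring).
      rewrite Cmod_0; simpl; nra. }
    rewrite Rabs_pos_eq by apply Hal.
    apply Rle_trans with ((/ 2) ^ tri i * (INR (S i) ^ 2 * 2 ^ S i * d)).
    { apply Rmult_le_compat; [apply Hal | apply Cmod_ge_0 | apply Hal | exact L]. }
    rewrite S_INR. generalize (Hdec i); intros.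
    change (2 ^ S i) with (2 * 2 ^ i). change ((/ 2) ^ S i) with (/ 2 * (/ 2) ^ i).
    nra. }
  set (SB := csum (fun i => RtoC (be i) * divdiff i v1 v2)%C N).
  set (SB' := csum (fun i => RtoC (be i) * divdiff i v3 v4)%C N).
  assert (B : Cmod (SB - SB') <= 2 * (M * (4 * d))).
  { unfold SB, SB'. rewrite <- csum_minus.
    eapply Rle_trans; [|apply rsum_geom_half; nra].
    apply Cmod_csum_le; intros i _.
    replace (RtoC (be i) * divdiff i v1 v2 - RtoC (be i) * divdiff i v3 v4)%C
      with (RtoC (be i) * (divdiff i v1 v2 - divdiff i v3 v4))%C by ring.
    rewrite Cmod_mult, Cmod_R, Rabs_pos_eq by apply Hbe.
    assert (L := divdiff_lipschitz i v1 v2 v3 v4 2 ltac:(lra) V1 V2 V3 V4).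
    apply Rle_trans with ((/ 2) ^ tri i * ((INR i + 1) ^ 2 * 2 ^ i * (4 * d))).
    { apply Rmult_le_compat; [apply Hbe | apply Cmod_ge_0 | apply Hbe |].
      eapply Rle_trans; [exact L|]. generalize (pos_INR i); intros.
      assert (0 < 2 ^ i) by (apply pow_lt; lra).
      apply Rmult_le_compat; [|apply Rplus_le_le_0_compat; apply Cmod_ge_0| |unfold d; lra].
      - apply Rmult_le_pos; [apply pow2_ge_0 | lra].
      - apply Rmult_le_compat_r; [lra|]. nra. }
    generalize (Hdec i); intros. nra. }
  assert (B' : Cmod SB' <= 2 * M).
  { unfold SB'. eapply Rle_trans; [|apply (rsum_geom_half M N HM)].
    apply Cmod_csum_le; intros i _.
    rewrite Cmod_mult, Cmod_R, Rabs_pos_eq by apply Hbe.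
    assert (L := divdiff_bound' i v3 v4 2 ltac:(lra) V3 V4).
    apply Rle_trans with ((/ 2) ^ tri i * ((INR i + 1) ^ 2 * 2 ^ i)).
    { apply Rmult_le_compat; [apply Hbe | apply Cmod_ge_0 | apply Hbe |].
      eapply Rle_trans; [exact L|]. generalize (pos_INR i); intros.
      assert (0 < 2 ^ i) by (apply pow_lt; lra).
      apply Rmult_le_compat_r; [lra|]. nra. }
    generalize (Hdec i); lra. }
  unfold laurent_dd. fold SB SB'.
  match goal with |- Cmod (?x - v1 * v2 * SB - (?y - v3 * v4 * SB')) <= _ =>
    replace (x - v1 * v2 * SB - (y - v3 * v4 * SB'))%C
      with ((x - y) + (- (v1 * v2 * (SB - SB'))
        + - (((v1 - v3) * v2 + v3 * (v2 - v4)) * SB')))%C by ring end.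
  eapply Rle_trans; [apply Cmod_triangle|].
  eapply Rle_trans; [apply Rplus_le_compat_l, Cmod_triangle|].
  rewrite !Cmod_opp, !Cmod_mult.
  assert (T := Cmod_triangle ((v1 - v3) * v2) (v3 * (v2 - v4))). rewrite !Cmod_mult in T.
  assert (X1 : Cmod v1 * Cmod v2 * Cmod (SB - SB') <= 2 * 2 * (2 * (M * (4 * d)))).
  { repeat apply Rmult_le_compat; auto using Cmod_ge_0.
    apply Rmult_le_pos; apply Cmod_ge_0. }
  assert (X2 : Cmod ((v1 - v3) * v2 + v3 * (v2 - v4)) <= 8 * d).
  { eapply Rle_trans; [exact T|].
    generalize (Cmod_ge_0 (v1 - v3)) (Cmod_ge_0 (v2 - v4)) (Cmod_ge_0 v2) (Cmod_ge_0 v3).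
    unfold d; intros.
    assert (Cmod (v1 - v3) * Cmod v2 <= 4 * Cmod (w1 - w3) * 2)
      by (apply Rmult_le_compat; easy).
    assert (Cmod v3 * Cmod (v2 - v4) <= 2 * (4 * Cmod (w2 - w4)))
      by (apply Rmult_le_compat; easy).
    lra. }
  assert (X3 : Cmod ((v1 - v3) * v2 + v3 * (v2 - v4)) * Cmod SB' <= 8 * d * (2 * M))
    by (apply Rmult_le_compat; auto using Cmod_ge_0).
  fold d. nra.
Qed.

(** If [p > 0], the radius [x k ^ (-1/2)] stays below [p ^ (-1/2)] and convergence of [c] is enough.
    If [p = 0], the radius tends to infinity, but then [L = 0] and [c k <= x k ^ i] leaves at most
    [x k ^ (i/2)]. Exponent 0 is exempt, since it serves the recentred coefficient of [w], whose
    limit is 1 even when [p = 0]. *)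
Lemma annulus_lim (x c : nat -> R) (p L : R) (i : nat) :
  (forall k, 0 < x k <= 1) -> (forall k, p <= x k) -> 0 <= p -> is_lim_seq x p ->
  (forall k, 0 <= c k) -> is_lim_seq c L ->
  i = O \/ ((forall k, c k <= x k ^ i) /\ (p = 0 -> L = 0)) ->
  is_lim_seq (fun k => (c k - L) * sqrt (/ x k) ^ i) 0.
Proof.
  intros Hx Hpx Hp Lx Hc Lc Hi.
  assert (L0 : is_lim_seq (fun k => c k - L) 0).
  { replace (Finite 0) with (Finite (L - L)) by (f_equal; ring).
    apply is_lim_seq_minus'; [easy | apply is_lim_seq_const]. }
  destruct i as [|i].
  { eapply is_lim_seq_ext; [|exact L0]. intros k; simpl; ring. }
  destruct Hi as [Hi|[Hcx HL]]; [easy|].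
  assert (Hs : forall k, 0 < sqrt (/ x k)).
  { intros k; apply sqrt_lt_R0, Rinv_0_lt_compat, Hx. }
  destruct Hp as [Hp|<-].
  - apply is_lim_seq_abs_0.
    apply is_lim_seq_le_le with (u := fun _ => 0)
      (w := fun k => Rabs (c k - L) * sqrt (/ p) ^ S i).
    + intros k; split; [apply Rabs_pos|].
      rewrite Rabs_mult, (Rabs_pos_eq (_ ^ _)) by (apply pow_le; left; apply Hs).
      apply Rmult_le_compat_l; [apply Rabs_pos|].
      apply pow_incr; split; [left; apply Hs|]. apply sqrt_le_1_alt.
      apply Rinv_le_contravar; [easy | apply Hpx].
    + apply is_lim_seq_const.
    + apply is_lim_seq_abs_0 in L0.
      replace (Finite 0) with (Rbar_mult (Finite 0) (Finite (sqrt (/ p) ^ S i)))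
        by (simpl; f_equal; ring).
      apply is_lim_seq_scal_r, L0.
  - rewrite (HL eq_refl).
    apply is_lim_seq_le_le with (u := fun _ => 0) (w := fun k => sqrt (x k)).
    + intros k. rewrite Rminus_0_r. assert (P := pow_lt _ (S i) (Hs k)).
      split; [apply Rmult_le_pos; [easy | lra]|].
      apply Rle_trans with (x k ^ S i * sqrt (/ x k) ^ S i).
      { apply Rmult_le_compat_r; [lra | apply Hcx]. }
      rewrite <- Rpow_mult_distr.
      assert (E : x k * sqrt (/ x k) = sqrt (x k)).
      { rewrite sqrt_inv. rewrite <- (sqrt_sqrt (x k)) at 1 by (left; apply Hx).
        field. apply Rgt_not_eq, sqrt_lt_R0, Hx. }
      rewrite E. simpl. assert (S0 := sqrt_pos (x k)).
      assert (S1 : sqrt (x k) <= 1).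
      { rewrite <- sqrt_1. apply sqrt_le_1_alt, Hx. }
      assert (sqrt (x k) ^ i <= 1) by (rewrite <- (pow1 i); apply pow_incr; easy).
      nra.
    + apply is_lim_seq_const.
    + rewrite <- sqrt_0. apply is_lim_seq_continuous; [|easy].
      apply continuity_pt_sqrt; lra.
Qed.

(** * Recentred coefficients of f and their limits *)

Section SecondQuotients.
Variable a : nat -> R.
Hypothesis a_pos : forall k, 0 < a k.

Definition ratio (k : nat) : R := a k / a (S k).

(** The inverse of the second quotient of index [k + 2]. *)
Definition shrink (k : nat) : R := ratio k / ratio (S k).

Hypothesis shrink_0 : shrink 0 <= 2 / 5.
Hypothesis shrink_decr : forall k, shrink (S k) <= shrink k.

Lemma ratio_pos (k : nat) : 0 < ratio k.
Proof. apply Rdiv_lt_0_compat; apply a_pos. Qed.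

Lemma shrink_pos (k : nat) : 0 < shrink k.
Proof. apply Rdiv_lt_0_compat; apply ratio_pos. Qed.

Lemma shrink_mono (k i : nat) : shrink (k + i) <= shrink k.
Proof.
  induction i as [|i IH]; [rewrite Nat.add_0_r; lra|].
  rewrite Nat.add_succ_r. generalize (shrink_decr (k + i)); lra.
Qed.

Lemma shrink_le (k : nat) : shrink k <= 2 / 5.
Proof. generalize (shrink_mono 0 k); simpl; lra. Qed.

Lemma ratio_S (k : nat) : ratio k = ratio (S k) * shrink k.
Proof. unfold shrink. generalize (ratio_pos (S k)); intros; field; lra. Qed.

Lemma a_S (k : nat) : a (S k) = a k / ratio k.
Proof. unfold ratio. generalize (a_pos k) (a_pos (S k)); intros; field; lra. Qed.

Definition up (k : nat) : nat -> R := coef_pos a k (ratio k).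
Definition down (k i : nat) : R := a (k - i)%nat / a k / ratio k ^ i.

Lemma up_0 (k : nat) : up k 0 = 1.
Proof.
  unfold up, coef_pos. rewrite Nat.add_0_r.
  generalize (a_pos k); intros; simpl; field; lra.
Qed.

Lemma up_S (k i : nat) : up k (S i) = up k i * (ratio k / ratio (k + i)).
Proof.
  unfold up, coef_pos. rewrite Nat.add_succ_r, a_S. simpl.
  generalize (a_pos k) (ratio_pos (k + i)); intros; field; lra.
Qed.

Lemma down_0 (k : nat) : down k 0 = 1.
Proof. unfold down. rewrite Nat.sub_0_r. generalize (a_pos k); intros; simpl; field; lra. Qed.

Lemma down_S (k i : nat) : (S i <= k)%nat ->
  down k (S i) = down k i * (ratio (k - S i) / ratio k).
Proof.
  intros H. unfold down. replace (k - i)%nat with (S (k - S i)) by lia.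
  rewrite a_S. simpl pow.
  assert (ratio k ^ i <> 0) by (apply pow_nonzero; generalize (ratio_pos k); lra).
  generalize (a_pos k) (ratio_pos k) (ratio_pos (k - S i)); intros; field; lra.
Qed.

Lemma up_pos (k i : nat) : 0 < up k i.
Proof.
  unfold up, coef_pos. apply Rmult_lt_0_compat; [apply Rdiv_lt_0_compat; apply a_pos|].
  apply pow_lt, ratio_pos.
Qed.

Lemma down_pos (k i : nat) : 0 < down k i.
Proof.
  apply Rdiv_lt_0_compat; [apply Rdiv_lt_0_compat; apply a_pos|]. apply pow_lt, ratio_pos.
Qed.

Lemma ratio_up_S (k i : nat) :
  ratio k / ratio (k + S i) = ratio k / ratio (k + i) * shrink (k + i).
Proof.
  rewrite Nat.add_succ_r. unfold shrink.
  generalize (ratio_pos (k + i)) (ratio_pos (S (k + i))); intros; field; lra.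
Qed.

Lemma ratio_up_le (k i : nat) : 0 < ratio k / ratio (k + i) <= shrink k ^ i.
Proof.
  split; [apply Rdiv_lt_0_compat; apply ratio_pos|].
  induction i as [|i IH].
  - rewrite Nat.add_0_r. generalize (ratio_pos k); intros.
    unfold Rdiv; rewrite Rinv_r by lra; simpl; lra.
  - rewrite ratio_up_S. simpl. rewrite Rmult_comm.
    apply Rmult_le_compat; try easy.
    + left; apply shrink_pos.
    + left; apply Rdiv_lt_0_compat; apply ratio_pos.
    + apply shrink_mono.
Qed.

Lemma ratio_down_S (k i : nat) : (S (S i) <= k)%nat ->
  ratio (k - S (S i)) / ratio k = ratio (k - S i) / ratio k * shrink (k - S (S i)).
Proof.
  intros H. rewrite (ratio_S (k - S (S i))). replace (S (k - S (S i))) with (k - S i)%nat by lia.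
  generalize (ratio_pos k); intros; field; lra.
Qed.

(** Below [k] the values of [shrink] are larger than [shrink (k - 1)], so only the first factor is
    kept as such and the earlier ones are replaced by 2/5. Above [k] monotonicity allows a pure
    power of [shrink k]. *)
Lemma ratio_down_le (k i : nat) : (S i <= k)%nat ->
  0 < ratio (k - S i) / ratio k <= shrink (k - 1) * (2 / 5) ^ i.
Proof.
  intros H. split; [apply Rdiv_lt_0_compat; apply ratio_pos|].
  induction i as [|i IH].
  - rewrite (ratio_S (k - 1)). replace (S (k - 1)) with k by lia.
    generalize (ratio_pos k); intros; right; simpl; field; lra.
  - rewrite ratio_down_S by easy.
    replace (shrink (k - 1) * (2 / 5) ^ S i) with (shrink (k - 1) * (2 / 5) ^ i * (2 / 5))
      by (simpl; ring).
    apply Rmult_le_compat.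
    + left; apply Rdiv_lt_0_compat; apply ratio_pos.
    + left; apply shrink_pos.
    + apply IH; lia.
    + apply shrink_le.
Qed.

Lemma up_le (k i : nat) : up k i <= theta_pos (shrink k) i.
Proof.
  unfold theta_pos; induction i as [|i IH]; [rewrite up_0; simpl; lra|].
  rewrite up_S. simpl tri. rewrite pow_add.
  destruct (ratio_up_le k i). generalize (up_pos k i); intros.
  apply Rmult_le_compat; lra.
Qed.

(** Each of the [i] ratios supplies one factor [shrink (k - 1)], enough to absorb the [i]-th power
    of the inner radius, while the powers of 2/5 supply the quadratic decay. *)
Lemma down_le (k i : nat) : (i <= k)%nat ->
  down k i <= shrink (k - 1) ^ i * (/ 2) ^ tri i.
Proof.
  induction i as [|i IH]; intros H; [rewrite down_0; simpl; lra|].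
  rewrite down_S by easy. simpl tri. rewrite pow_add.
  destruct (ratio_down_le k i H) as [H1 H2]. generalize (down_pos k i); intros.
  assert ((2 / 5) ^ i <= (/ 2) ^ i) by (apply pow_incr; lra).
  assert (H5 : ratio (k - S i) / ratio k <= shrink (k - 1) * (/ 2) ^ i).
  { eapply Rle_trans; [apply H2|]. apply Rmult_le_compat_l; [left; apply shrink_pos | easy]. }
  replace (shrink (k - 1) ^ S i * ((/ 2) ^ tri i * (/ 2) ^ i))
    with (shrink (k - 1) ^ i * (/ 2) ^ tri i * (shrink (k - 1) * (/ 2) ^ i)) by (simpl; ring).
  apply Rmult_le_compat; try lra. apply IH; lia.
Qed.

(** The margin above 1 makes every annulus contain the point [-(1 + d)], for d <= 1/8, that is
    needed to separate zeros. *)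
Lemma radius_ge1 (k : nat) : 5 / 4 <= sqrt (/ shrink k).
Proof.
  rewrite <- (sqrt_pow2 (5 / 4)) by lra. apply sqrt_le_1_alt.
  apply Rle_trans with (/ (2 / 5)); [lra|].
  apply Rinv_le_contravar; [apply shrink_pos | apply shrink_le].
Qed.

Lemma radius_sq (k : nat) : shrink k * sqrt (/ shrink k) ^ 2 = 1.
Proof.
  rewrite pow2_sqrt by (left; apply Rinv_0_lt_compat, shrink_pos).
  generalize (shrink_pos k); intros; field; lra.
Qed.

Lemma up_dominated (k : nat) : dominated (up k) (sqrt (/ shrink k)).
Proof.
  assert (R := radius_ge1 k). apply (dominated_le _ (theta_pos (shrink k))).
  - lra.
  - intros i; split; [left; apply up_pos | apply up_le].
  - apply theta_pos_dominated; [split; [left; apply shrink_pos | apply shrink_le] | lra |].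
    rewrite radius_sq; lra.
Qed.

Definition down0 (k : nat) : nat -> R := coef_neg a k (ratio k).

Lemma down0_bounds (k i : nat) :
  0 <= down0 k i <= shrink (k - 1) ^ i * (/ 2) ^ tri i.
Proof.
  assert (P : 0 <= shrink (k - 1) ^ i * (/ 2) ^ tri i).
  { apply Rmult_le_pos; apply pow_le; [left; apply shrink_pos | lra]. }
  unfold down0, coef_neg. destruct i as [|i]; [lra|].
  destruct (Nat.leb_spec (S i) k) as [H|H]; [|lra].
  split; [left; apply down_pos | apply (down_le k (S i) H)].
Qed.

Lemma down_dominated (k : nat) : dominated' (down0 k) (sqrt (/ shrink (k - 1))).
Proof.
  intros i. destruct (down0_bounds k i) as [H1 H2]. split; [easy|].
  assert (R := radius_ge1 (k - 1)). assert (R2 := radius_sq (k - 1)).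
  assert (Y := shrink_pos (k - 1)).
  set (y := shrink (k - 1)) in *. set (rho := sqrt (/ y)) in *.
  assert (P : 0 < rho ^ i) by (apply pow_lt; lra).
  assert (Q : 0 <= (/ 2) ^ tri i) by (apply pow_le; lra).
  apply Rle_trans with ((y ^ i * (/ 2) ^ tri i) * rho ^ i).
  - apply Rmult_le_compat_r; lra.
  - replace (y ^ i * (/ 2) ^ tri i * rho ^ i) with ((y * rho) ^ i * (/ 2) ^ tri i)
      by (rewrite Rpow_mult_distr; ring).
    assert (0 <= y * rho <= 1) by (split; nra).
    assert ((y * rho) ^ i <= 1) by (rewrite <- (pow1 i); apply pow_incr; easy).
    nra.
Qed.

Lemma shrink_lim : exists p, 0 <= p <= 2 / 5 /\ (forall k, p <= shrink k) /\
  is_lim_seq shrink p.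
Proof.
  destruct (ex_finite_lim_seq_decr shrink 0) as [p Hp];
    [easy | intros; left; apply shrink_pos|].
  assert (Hle : forall k, p <= shrink k).
  { intros k. apply (is_lim_seq_decr_compare shrink p Hp shrink_decr). }
  exists p; repeat split; auto.
  - apply (is_lim_seq_le (fun _ => 0) shrink 0 p); auto using is_lim_seq_const.
    intros; left; apply shrink_pos.
  - generalize (Hle O); lra.
Qed.

Lemma up_lim (p : R) (i : nat) : is_lim_seq shrink p ->
  is_lim_seq (fun k => up k i) (theta_pos p i).
Proof.
  intros L. unfold theta_pos; induction i as [|i IH].
  - eapply is_lim_seq_ext; [intros k; symmetry; apply up_0 | apply is_lim_seq_const].
  - eapply is_lim_seq_ext; [intros k; symmetry; apply up_S|].
    simpl tri. rewrite pow_add. apply is_lim_seq_mult'; [easy|]. clear IH.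
    induction i as [|i IH].
    + eapply is_lim_seq_ext; [|apply is_lim_seq_const].
      intros k; rewrite Nat.add_0_r; generalize (ratio_pos k); intros; simpl; field; lra.
    + eapply is_lim_seq_ext; [intros k; symmetry; apply ratio_up_S|].
      replace (Finite (p ^ S i)) with (Finite (p ^ i * p)) by (f_equal; simpl; ring).
      apply is_lim_seq_mult'; [easy|]. apply (is_lim_seq_incr_n shrink i), L.
Qed.

Lemma down_lim (p : R) (i : nat) : is_lim_seq shrink p ->
  is_lim_seq (fun k => down0 k i) (theta_neg p i).
Proof.
  intros L.
  assert (Ls : forall j, is_lim_seq (fun k => shrink (k - j)) p).
  { intros j. apply (is_lim_seq_incr_n _ j). eapply is_lim_seq_ext; [|apply L].
    intros n; cbv beta; f_equal; lia. }
  assert (D : is_lim_seq (fun k => down k i) (p ^ tri (S i))).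
  { induction i as [|i IH].
    - eapply is_lim_seq_ext; [intros k; symmetry; apply down_0 | apply is_lim_seq_const].
    - eapply is_lim_seq_ext_loc; [exists (S i); intros k Hk; symmetry; apply down_S, Hk|].
      change (tri (S (S i))) with (tri (S i) + S i)%nat. rewrite pow_add.
      apply is_lim_seq_mult'; [easy|]. clear IH.
      induction i as [|i IH].
      + eapply is_lim_seq_ext_loc; [|rewrite pow_1; apply (Ls 1%nat)].
        exists 1%nat; intros k Hk. rewrite (ratio_S (k - 1)).
        replace (S (k - 1)) with k by lia. generalize (ratio_pos k); intros; field; lra.
      + eapply is_lim_seq_ext_loc;
          [exists (S (S i)); intros k Hk; symmetry; apply ratio_down_S, Hk|].
        replace (Finite (p ^ S (S i))) with (Finite (p ^ S i * p))
          by (f_equal; simpl; ring).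
        apply is_lim_seq_mult'; auto. }
  destruct i as [|i]; [apply is_lim_seq_const|].
  eapply is_lim_seq_ext_loc; [|apply D].
  exists (S i); intros k Hk. unfold down0, coef_neg.
  destruct (Nat.leb_spec (S i) k); [easy|lia].
Qed.

(** Transfers [theta_lower] and [theta_m1_small] to the recentred series. The order of the
    quantifiers matters: [eps] is later chosen in terms of [s]. *)
Lemma recentred_lower : exists s, 0 < s /\ forall eps, 0 < eps ->
  exists K, (1 <= K)%nat /\ exists N0, forall k N, (K <= k)%nat -> (N0 <= N)%nat ->
  Cmod (laurent (up k) (down0 k) N (-(1)) (-(1))) <= eps /\
  forall w v, (w * v = 1)%C -> w <> (-(1))%C ->
    Cmod w <= sqrt (/ shrink k) -> Cmod v <= sqrt (/ shrink (k - 1)) ->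
    s <= Cmod (laurent_dd (up k) (down0 k) N w v (-(1)) (-(1))).
Proof.
  destruct shrink_lim as [p [Hp [Hpx L]]].
  destruct (theta_lower p Hp) as [s [Hs [N1 HT]]].
  exists (s / 2); split; [lra|]. intros eps Heps.
  destruct (theta_m1_small p Hp (eps / 2) ltac:(lra)) as [N2 HM].
  assert (HR : forall k, 1 <= sqrt (/ shrink k)) by (intros k; generalize (radius_ge1 k); lra).
  (* Since [p <= shrink k], every annulus lies inside the one on which theta is controlled. *)
  assert (Sub : forall k w, Cmod w <= sqrt (/ shrink k) -> p * Cmod w ^ 2 <= 1).
  { intros k w H. rewrite <- (radius_sq k).
    apply Rmult_le_compat; [lra | apply pow2_ge_0 | apply Hpx |].
    apply pow_incr; split; [apply Cmod_ge_0 | easy]. }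
  assert (Sub' : forall k, p * sqrt (/ shrink k) ^ 2 <= 1).
  { intros k. rewrite <- (radius_sq k).
    apply Rmult_le_compat_r; [apply pow2_ge_0 | apply Hpx]. }
  assert (Hx : forall k, 0 < shrink k <= 1).
  { intros k; generalize (shrink_pos k) (shrink_le k); lra. }
  (* The tolerance serves two purposes: [eps / 2] for the value at -1, [s / 2] for the divided
     difference. *)
  destruct (laurent_limit up down0 (fun _ => theta_pos p) (fun _ => theta_neg p)
    (fun k => sqrt (/ shrink k)) (fun k => sqrt (/ shrink (k - 1))))
    with (eps := Rmin (eps / 2) (s / 2)) as [K HK]; try easy.
  - exists O; intros k _.
    refine (conj (up_dominated k) (conj _ (conj (down_dominated k) _))).
    + apply theta_pos_dominated; auto.
    + apply theta_neg_dominated; auto.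
  - intros i. apply (annulus_lim shrink (fun k => up k (S i)) p); auto; try lra.
    + intros; left; apply up_pos.
    + apply up_lim, L.
    + destruct i as [|i]; [now left|right]. split.
      * intros k. eapply Rle_trans; [apply up_le|]. unfold theta_pos.
        change (tri (S (S i))) with (tri (S i) + S i)%nat. rewrite pow_add.
        assert (shrink k ^ tri (S i) <= 1).
        { rewrite <- (pow1 (tri (S i))). apply pow_incr; generalize (Hx k); lra. }
        assert (0 < shrink k ^ S i) by (apply pow_lt, Hx). nra.
      * intros ->. unfold theta_pos. change (tri (S (S i))) with (tri (S i) + S i)%nat.
        rewrite Nat.add_succ_r; simpl; ring.
  - intros i.
    apply (annulus_lim (fun k => shrink (k - 1)) (fun k => down0 k i) p);
      auto; try lra.
    + apply (is_lim_seq_incr_1 (fun k => shrink (k - 1))).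
      eapply is_lim_seq_ext; [|apply L]. intros n; f_equal; lia.
    + intros; apply down0_bounds.
    + apply down_lim, L.
    + destruct i as [|i]; [now left|right]. split.
      * intros k. eapply Rle_trans; [apply down0_bounds|].
        assert ((/ 2) ^ tri (S i) <= 1).
        { rewrite <- (pow1 (tri (S i))). apply pow_incr; lra. }
        assert (0 < shrink (k - 1) ^ S i) by (apply pow_lt, Hx). nra.
      * intros ->. unfold theta_neg. change (tri (S (S i))) with (tri (S i) + S i)%nat.
        rewrite Nat.add_succ_r; simpl; ring.
  - apply Rmin_glb_lt; lra.
  - exists (S K); split; [lia|]. exists (max N1 N2); intros k N Hk HN.
    specialize (HK k N ltac:(lia)).
    assert (E1 := Rmin_l (eps / 2) (s / 2)). assert (E2 := Rmin_r (eps / 2) (s / 2)).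
    split.
    + assert (C := laurent_compare_m1 (up k) (down0 k) (theta_pos p) (theta_neg p) N
        (sqrt (/ shrink k)) (sqrt (/ shrink (k - 1))) (HR _) (HR _) (up_0 k) eq_refl).
      specialize (HM N ltac:(lia)).
      set (A := laurent (up k) _ _ _ _) in *.
      set (B := laurent (theta_pos p) _ _ _ _) in *.
      assert (T := Cmod_triangle (A - B) B). replace (A - B + B)%C with A in T by ring. lra.
    + intros w v Hwv Hw1 Hw Hv.
      assert (C := laurent_dd_compare (up k) (down0 k) (theta_pos p) (theta_neg p) N w v
        _ _ (HR _) (HR _) Hw Hv).
      specialize (HT N w v ltac:(lia) Hwv Hw1 (Sub _ _ Hw) (Sub _ _ Hv)).
      set (A := laurent_dd (up k) _ _ _ _ _ _) in *.
      set (B := laurent_dd (theta_pos p) _ _ _ _ _ _) in *.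
      assert (T := Cmod_triangle (B - A) A). replace (B - A + A)%C with B in T by ring.
      assert (Cmod (B - A) = Cmod (A - B)).
      { rewrite <- Cmod_opp. f_equal. ring. }
      lra.
Qed.


(** * Location and separation of the large zeros *)

Variable f : C -> C.
Hypothesis f_sum : forall z eps, 0 < eps -> exists N0, forall N, (N0 <= N)%nat ->
  Cmod (csum (fun j => RtoC (a j) * z ^ j)%C N - f z) < eps.

Lemma f_recentred (k N : nat) (w v : C) : (w * v = 1)%C -> (k < N)%nat ->
  Cmod (csum (fun j => RtoC (a j) * (RtoC (ratio k) * w) ^ j)%C (k + N))
  = a k * (ratio k * Cmod w) ^ k * Cmod (laurent (up k) (down0 k) N w v).
Proof.
  intros Hwv HN. rewrite (laurent_recentre a k N (ratio k) w v); auto.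
  - rewrite !Cmod_mult, Cmod_pow, Cmod_mult, !Cmod_R, !Rabs_pos_eq; [easy|..];
      left; [apply ratio_pos | apply a_pos].
  - apply Rgt_not_eq, a_pos.
  - apply ratio_pos.
Qed.

Lemma inv_nz (w v : C) : (w * v = 1)%C -> 0 < Cmod w.
Proof.
  intros H. apply Cmod_gt_0. intros ->. rewrite Cmult_0_l in H.
  apply RtoC_inj in H; lra.
Qed.

Lemma recentred_scale_pos (k : nat) (w v : C) : (w * v = 1)%C ->
  0 < a k * (ratio k * Cmod w) ^ k.
Proof.
  intros H. apply Rmult_lt_0_compat; [apply a_pos|]. apply pow_lt, Rmult_lt_0_compat.
  - apply ratio_pos.
  - apply (inv_nz w v H).
Qed.

Lemma laurent_zero_lim (k : nat) (w v : C) : (w * v = 1)%C ->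
  f (RtoC (ratio k) * w)%C = 0%C -> forall eps, 0 < eps -> exists N0, forall N, (N0 <= N)%nat ->
  Cmod (laurent (up k) (down0 k) N w v) <= eps.
Proof.
  intros Hwv Hz eps Heps. assert (P := recentred_scale_pos k w v Hwv).
  destruct (f_sum (RtoC (ratio k) * w)%C (a k * (ratio k * Cmod w) ^ k * eps)) as [N0 HN0].
  { apply Rmult_lt_0_compat; easy. }
  exists (max N0 (S k)); intros N HN.
  specialize (HN0 (k + N)%nat ltac:(lia)). rewrite Hz in HN0.
  replace (csum (fun j => RtoC (a j) * (RtoC (ratio k) * w) ^ j) (k + N) - 0)%C
    with (csum (fun j => RtoC (a j) * (RtoC (ratio k) * w) ^ j) (k + N))%C in HN0 by ring.
  rewrite (f_recentred k N w v Hwv) in HN0 by lia.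
  apply Rmult_lt_reg_l in HN0; [lra | easy].
Qed.

Lemma near_m1_bounds (w : C) (d : R) : Cmod (w + 1) <= d -> d <= / 4 ->
  Cmod w <= 2 /\ / 2 <= Cmod w /\ (w * / w = 1)%C /\ Cmod (/ w) <= 2.
Proof.
  intros H Hd.
  assert (T1 := Cmod_triangle (w + 1) (-(1))). assert (T2 := Cmod_triangle (w + 1) (- w)).
  replace (w + 1 + - (1))%C with w in T1 by ring.
  replace (w + 1 + - w)%C with (RtoC 1) in T2 by ring.
  rewrite Cmod_m1 in T1. rewrite Cmod_opp, Cmod_1 in T2.
  assert (Hw : (w <> 0)%C) by (apply Cmod_gt_0; lra).
  repeat split; try lra.
  - apply Cinv_r, Hw.
  - rewrite Cmod_inv by easy. rewrite <- (Rinv_inv 2). apply Rinv_le_contravar; lra.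
Qed.

(** The second claim is quantitative injectivity, stated for [f] so that the infinite Laurent series
    need not be defined. The larger disc of radius [2 * d] leaves room for the conjugate of a zero
    and for all points within [d] of it. *)
Lemma zero_separation : exists d s, 0 < d <= / 8 /\ 0 < s /\ exists K, (1 <= K)%nat /\
  forall k, (K <= k)%nat ->
  (forall w v, (w * v = 1)%C -> f (RtoC (ratio k) * w)%C = 0%C ->
    Cmod w <= sqrt (/ shrink k) -> Cmod v <= sqrt (/ shrink (k - 1)) -> Cmod (w + 1) <= d) /\
  (forall w1 w2, f (RtoC (ratio k) * w1)%C = 0%C -> Cmod (w1 + 1) <= d -> Cmod (w2 + 1) <= 2 * d ->
    s * (a k * (ratio k * Cmod w2) ^ k) * Cmod (w2 - w1) <= Cmod (f (RtoC (ratio k) * w2)%C)).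
Proof.
  destruct recentred_lower as [s [Hs HL]].
  destruct laurent_dd_lipschitz as [K0 [HK0 Lip]].
  (* The first bound keeps [2 * d] within the range of [near_m1_bounds]. The second makes the
     Lipschitz error [K0 * (4 * d)] at most half of the lower bound [s]. *)
  set (d := Rmin (/ 8) (s / (8 * K0))).
  assert (Hd : 0 < d) by (apply Rmin_glb_lt; [lra | apply Rdiv_lt_0_compat; lra]).
  assert (Hd1 : d <= / 8) by apply Rmin_l.
  assert (Hd2 : K0 * (4 * d) <= s / 2).
  { apply Rle_trans with (K0 * (4 * (s / (8 * K0)))).
    - apply Rmult_le_compat_l; [lra|]. apply Rmult_le_compat_l; [lra | apply Rmin_r].
    - right; field; lra. }
  clearbody d.
  exists d, (s / 2); repeat split; try lra.
  destruct (HL (s * d / 2)) as [K [HK1 [N0 HK]]].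
  { assert (0 < s * d) by (apply Rmult_lt_0_compat; easy). lra. }
  exists K; split; [easy|]. intros k Hk. split.
  (* Here [s * |w + 1|] is at most the sum of the moduli at [w] and at -1. Each is at most
     [s * d / 2]: at [w] for many terms because [w] is a zero, at -1 for large [k]. *)
  - intros w v Hwv Hz Hw Hv.
    destruct (Ceq_dec w (-(1))%C) as [->|Hne].
    { replace (- (1) + 1)%C with (RtoC 0) by ring. rewrite Cmod_0; lra. }
    destruct (laurent_zero_lim k w v Hwv Hz (s * d / 2)) as [N1 HN1].
    { assert (0 < s * d) by (apply Rmult_lt_0_compat; easy). lra. }
    set (N := max N0 N1).
    destruct (HK k N Hk ltac:(lia)) as [H1 H2].
    specialize (H2 w v Hwv Hne Hw Hv). specialize (HN1 N ltac:(lia)).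
    assert (D := laurent_diff (up k) (down0 k) N w v (-(1)) (-(1)) Hwv ltac:(ring)).
    replace (w - - (1))%C with (w + 1)%C in D by ring.
    apply Rmult_le_reg_l with s; [easy|].
    apply Rle_trans with (Cmod ((w + 1) * laurent_dd (up k) (down0 k) N w v (- (1)) (- (1)))).
    { rewrite Cmod_mult, Rmult_comm. apply Rmult_le_compat_l; [apply Cmod_ge_0 | easy]. }
    rewrite <- D. unfold Cminus. eapply Rle_trans; [apply Cmod_triangle|].
    rewrite Cmod_opp. lra.
  - intros w1 w2 Hz Hw1 Hw2.
    destruct (near_m1_bounds w1 d Hw1 ltac:(lra)) as [A1 [A2 [A3 A4]]].
    destruct (near_m1_bounds w2 (2 * d) Hw2 ltac:(lra)) as [B1 [B2 [B3 B4]]].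
    (* The lower bound excludes -1 as its free argument, so the nodes [w1], [w2] are compared with
       [w3], -1 for a nearby [w3]. The total displacement is at most [4 * d]. *)
    set (w3 := RtoC (- (1 + d))).
    assert (M3 : Cmod w3 = 1 + d) by (unfold w3; rewrite Cmod_R, Rabs_Ropp, Rabs_pos_eq; lra).
    assert (Hw3 : (w3 <> 0)%C) by (apply Cmod_gt_0; lra).
    assert (E3 : (w3 * / w3 = 1)%C) by (apply Cinv_r, Hw3).
    assert (M3' : Cmod (/ w3) <= 1).
    { rewrite Cmod_inv by easy. rewrite M3, <- Rinv_1. apply Rinv_le_contravar; lra. }
    assert (Dif : Cmod (w1 - w3) <= 2 * d).
    { replace (w1 - w3)%C with ((w1 + 1) + RtoC d)%C
        by (unfold w3; rewrite RtoC_opp, RtoC_plus; ring).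
      eapply Rle_trans; [apply Cmod_triangle|]. rewrite Cmod_R, Rabs_pos_eq; lra. }
    assert (DD : forall N, (N0 <= N)%nat ->
      s / 2 <= Cmod (laurent_dd (up k) (down0 k) N w1 (/ w1) w2 (/ w2))).
    { intros N HN. destruct (HK k N Hk HN) as [_ H2].
      assert (R1 := radius_ge1 k). assert (R2 := radius_ge1 (k - 1)).
      specialize (H2 w3 (/ w3)%C E3).
      assert (Hne : w3 <> (- (1))%C).
      { unfold w3. rewrite <- RtoC_opp. intros H; apply RtoC_inj in H; lra. }
      specialize (H2 Hne ltac:(lra) ltac:(lra)).
      assert (L := Lip (up k) (down0 k) N w1 w2 w3 (-(1))%C (/ w1)%C (/ w2)%C (/ w3)%C (-(1))%C).
      assert (U : forall i, 0 <= up k (S i) <= (/ 2) ^ tri i).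
      { intros i. destruct (up_dominated k i) as [U1 U2]. split; [easy|].
        assert (1 <= sqrt (/ shrink k) ^ i) by (apply pow_R1_Rle; lra).
        eapply Rle_trans; [|exact U2]. nra. }
      assert (V : forall i, 0 <= down0 k i <= (/ 2) ^ tri i).
      { intros i. destruct (down_dominated k i) as [U1 U2]. split; [easy|].
        assert (1 <= sqrt (/ shrink (k - 1)) ^ i) by (apply pow_R1_Rle; lra).
        eapply Rle_trans; [|exact U2]. nra. }
      specialize (L U V A3 B3 E3 ltac:(ring) A1 B1 ltac:(lra)).
      rewrite Cmod_m1 in L. specialize (L ltac:(lra) A4 B4 ltac:(lra) ltac:(lra)).
      replace (w2 - - (1))%C with (w2 + 1)%C in L by ring.
      assert (K0 * (Cmod (w1 - w3) + Cmod (w2 + 1)) <= K0 * (4 * d))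
        by (apply Rmult_le_compat_l; lra).
      set (X := laurent_dd _ _ _ w1 _ _ _) in *. set (Y := laurent_dd _ _ _ w3 _ _ _) in *.
      assert (T := Cmod_triangle (- (X - Y)) X).
      replace (- (X - Y) + X)%C with Y in T by ring. rewrite Cmod_opp in T. lra. }
    set (c := a k * (ratio k * Cmod w2) ^ k).
    assert (Hc : 0 < c) by apply (recentred_scale_pos k w2 (/ w2)%C B3).
    apply le_epsilon; intros eps Heps.
    destruct (laurent_zero_lim k w1 (/ w1)%C A3 Hz (eps / 2 / c)) as [N1 HN1].
    { apply Rdiv_lt_0_compat; lra. }
    destruct (f_sum (RtoC (ratio k) * w2)%C (eps / 2) ltac:(lra)) as [N2 HN2].
    set (N := max (max N0 N1) (max N2 (S k))).
    specialize (HN1 N ltac:(lia)). specialize (HN2 (k + N)%nat ltac:(lia)).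
    specialize (DD N ltac:(lia)).
    assert (F := f_recentred k N w2 (/ w2)%C B3 ltac:(lia)). fold c in F.
    assert (D := laurent_diff (up k) (down0 k) N w1 (/ w1) w2 (/ w2) A3 B3).
    set (G1 := laurent _ _ _ w1 _) in *. set (G2 := laurent _ _ _ w2 _) in *.
    set (S2 := csum _ _) in *. set (DX := laurent_dd _ _ _ _ _ _ _) in *.
    assert (T1 := Cmod_triangle (S2 - f (RtoC (ratio k) * w2)) (f (RtoC (ratio k) * w2))).
    match type of T1 with Cmod ?x <= _ => replace x with S2 in T1 by ring end.
    assert (T2 := Cmod_triangle (- (G1 - G2)) G1).
    replace (- (G1 - G2) + G1)%C with G2 in T2 by ring.
    assert (T4 : Cmod (G1 - G2) <= Cmod G1 + Cmod G2).
    { unfold Cminus. eapply Rle_trans; [apply Cmod_triangle|]. rewrite Cmod_opp; lra. }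
    rewrite D, Cmod_mult in T4.
    replace (Cmod (w1 - w2)) with (Cmod (w2 - w1)) in T4
      by (rewrite <- Cmod_opp; f_equal; ring).
    assert (Q : s / 2 * Cmod (w2 - w1) <= eps / 2 / c + Cmod G2).
    { generalize (Cmod_ge_0 (w2 - w1)); nra. }
    apply Rmult_le_compat_l with (r := c) in Q; [|lra].
    replace (c * (eps / 2 / c + Cmod G2)) with (eps / 2 + c * Cmod G2) in Q by (field; lra).
    lra.
Qed.

(** In the z-plane consecutive annuli share a boundary circle, whose squared radius is
    [E k = ratio k * ratio (S k)]. These numbers at least double at each step, so every large [z]
    falls between two of them. *)
Lemma annulus_cover (K : nat) : (1 <= K)%nat -> exists R0, 0 < R0 /\ forall z, R0 <= Cmod z ->
  exists k, (K <= k)%nat /\ exists w v, (w * v = 1)%C /\ z = (RtoC (ratio k) * w)%C /\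
    Cmod w <= sqrt (/ shrink k) /\ Cmod v <= sqrt (/ shrink (k - 1)).
Proof.
  intros HK. set (E := fun k => ratio k * ratio (S k)).
  assert (HE : forall k, 0 < E k) by (intros; apply Rmult_lt_0_compat; apply ratio_pos).
  assert (G : forall k, 2 * E k <= E (S k)).
  { intros k. unfold E. rewrite (ratio_S k).
    generalize (ratio_pos (S k)) (ratio_pos (S (S k))) (shrink_le k) (shrink_pos k)
      (ratio_S (S k)) (shrink_le (S k)) (shrink_pos (S k)); intros.
    assert (ratio (S k) <= ratio (S (S k)) * (2 / 5)) by nra.
    assert (ratio (S k) * shrink k * ratio (S k) <= ratio (S k) * (2 / 5) * ratio (S k)) by nra.
    nra. }
  assert (Gp : forall n, 2 ^ n * E K <= E (n + K)%nat).
  { intros n; induction n as [|n IH]; [simpl; lra|].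
    simpl. generalize (G (n + K)%nat); lra. }
  exists (sqrt (E K)); split; [apply sqrt_lt_R0, HE|]. intros z Hz.
  assert (Hz2 : E K <= Cmod z ^ 2).
  { rewrite <- (pow2_sqrt (E K)) by (left; apply HE).
    apply pow_incr; split; [apply sqrt_pos | easy]. }
  assert (Hex : exists n, Cmod z ^ 2 <= E (n + K)%nat).
  { destruct (Pow_x_infinity 2 ltac:(rewrite Rabs_pos_eq; lra) (Cmod z ^ 2 / E K)) as [n Hn].
    exists n. specialize (Hn n (le_n _)). eapply Rle_trans; [|apply Gp].
    rewrite Rabs_pos_eq in Hn by (apply pow_le; lra).
    apply Rle_div_l; [apply HE | lra]. }
  assert (Hk : exists k, (K <= k)%nat /\ E k <= Cmod z ^ 2 <= E (S k)).
  { destruct Hex as [n Hn]. induction n as [|n IH].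
    - exists K; repeat split; auto. generalize (G K) (HE K); simpl in Hn; lra.
    - destruct (Rle_lt_dec (Cmod z ^ 2) (E (n + K)%nat)) as [H|H]; [auto|].
      exists (n + K)%nat; repeat split; [lia | lra | exact Hn]. }
  destruct Hk as [k [Hk [H1 H2]]].
  (* [E k] and [E (S k)] are the inner and outer squared radii of the annulus centred on
     [ratio (S k)], hence the index. *)
  exists (S k); split; [lia|].
  assert (R := ratio_pos (S k)). set (r := ratio (S k)) in *.
  assert (Hrc : RtoC r <> 0%C) by (intros H; apply RtoC_inj in H; lra).
  assert (Hz0 : 0 < Cmod z) by (generalize (HE k) (Cmod_ge_0 z); nra).
  assert (Hzc : z <> 0%C) by (apply Cmod_gt_0; easy).
  exists (z / RtoC r)%C, (RtoC r / z)%C. repeat split.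
  - field; auto.
  - field; auto.
  - rewrite Cmod_div, Cmod_R, Rabs_pos_eq by (auto; lra).
    rewrite <- (sqrt_pow2 (Cmod z / r)) by (apply Rlt_le, Rdiv_lt_0_compat; lra).
    apply sqrt_le_1_alt. unfold shrink. fold r.
    generalize (ratio_pos (S (S k))); intros.
    replace (/ (r / ratio (S (S k)))) with (E (S k) / r ^ 2) by (unfold E; fold r; field; lra).
    replace ((Cmod z / r) ^ 2) with (Cmod z ^ 2 / r ^ 2) by (field; lra).
    apply Rmult_le_compat_r; [left; apply Rinv_0_lt_compat, pow_lt; lra | easy].
  - replace (S k - 1)%nat with k by lia.
    rewrite Cmod_div, Cmod_R, Rabs_pos_eq by (auto; lra).
    rewrite <- (sqrt_pow2 (r / Cmod z)) by (apply Rlt_le, Rdiv_lt_0_compat; lra).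
    apply sqrt_le_1_alt. unfold shrink. fold r.
    generalize (ratio_pos k); intros.
    replace (/ (ratio k / r)) with (r ^ 2 / E k) by (unfold E; fold r; field; lra).
    replace ((r / Cmod z) ^ 2) with (r ^ 2 / Cmod z ^ 2) by (field; lra).
    apply Rmult_le_compat_l; [apply pow2_ge_0|].
    apply Rinv_le_contravar; [apply HE | easy].
Qed.

Lemma f_conj_zero (z : C) : f z = 0%C -> f (Cconj z) = 0%C.
Proof.
  intros Hz. apply Cmod_eq_0, Rle_antisym; [|apply Cmod_ge_0].
  apply le_epsilon; intros eps Heps.
  destruct (f_sum z (eps / 2) ltac:(lra)) as [N1 H1].
  destruct (f_sum (Cconj z) (eps / 2) ltac:(lra)) as [N2 H2].
  set (N := max N1 N2). specialize (H1 N ltac:(lia)). specialize (H2 N ltac:(lia)).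
  assert (E : csum (fun j => RtoC (a j) * Cconj z ^ j)%C N
    = Cconj (csum (fun j => RtoC (a j) * z ^ j)%C N)).
  { clear. generalize N as n. intros n; induction n as [|n IH]; simpl.
    - apply injective_projections; simpl; ring.
    - rewrite IH, Cplus_conj, Cmult_conj, Cpow_conj. do 2 f_equal.
      apply injective_projections; simpl; ring. }
  rewrite Hz in H1. rewrite E in H2.
  set (X := csum _ _) in *.
  replace (X - 0)%C with X in H1 by ring. rewrite <- Cmod_conj in H1.
  assert (T := Cmod_triangle (- (Cconj X - f (Cconj z))) (Cconj X)).
  replace (- (Cconj X - f (Cconj z)) + Cconj X)%C with (f (Cconj z)) in T by ring.
  rewrite Cmod_opp in T. lra.
Qed.

(** A zero is compared with its conjugate, also a zero, which forces it to be real, and then with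
    arbitrary nearby points. The resulting linear lower bound encodes simplicity before any
    derivative is available. *)
Lemma far_zeros : exists R0, 0 < R0 /\ forall z, R0 <= Cmod z -> f z = 0%C ->
  Im z = 0 /\ exists s e, 0 < s /\ 0 < e /\
    forall x, Cmod (x - z) <= e -> s * Cmod (x - z) <= Cmod (f x).
Proof.
  destruct zero_separation as [d [s [Hd [Hs [K [HK1 HK]]]]]].
  destruct (annulus_cover K HK1) as [R0 [HR0 HC]].
  exists R0; split; [easy|]. intros z Hz Hfz.
  destruct (HC z Hz) as [k [Hk [w [v [Hwv [-> [Hw Hv]]]]]]].
  destruct (HK k Hk) as [Loc Sep].
  assert (R := ratio_pos k). set (r := ratio k) in *.
  assert (Hrc : RtoC r <> 0%C) by (intros H; apply RtoC_inj in H; lra).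
  assert (W := Loc w v Hwv Hfz Hw Hv).
  (* The scale factor in the separation estimate depends on the second point; [|w'| >= 1/2] replaces
     it by a constant. *)
  assert (Pos : forall w', Cmod (w' + 1) <= 2 * d ->
    0 < s * (a k * (r * / 2) ^ k) <= s * (a k * (r * Cmod w') ^ k)).
  { intros w' H. destruct (near_m1_bounds w' (2 * d) H ltac:(lra)) as [_ [B _]].
    generalize (a_pos k); intros. split.
    - repeat apply Rmult_lt_0_compat; try lra. apply pow_lt; lra.
    - apply Rmult_le_compat_l; [lra|]. apply Rmult_le_compat_l; [lra|].
      apply pow_incr; split; nra. }
  split.
  - assert (Hcj : Cmod (Cconj w + 1) <= 2 * d).
    { replace (Cconj w + 1)%C with (Cconj (w + 1)).
      - rewrite Cmod_conj; lra.
      - apply injective_projections; simpl; ring. }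
    assert (S1 := Sep w (Cconj w) Hfz W Hcj).
    replace (RtoC r * Cconj w)%C with (Cconj (RtoC r * w)) in S1
      by (apply injective_projections; simpl; ring).
    rewrite (f_conj_zero _ Hfz), Cmod_0 in S1.
    destruct (Pos _ Hcj) as [P1 P2].
    assert (Z : Cmod (Cconj w - w) = 0) by (generalize (Cmod_ge_0 (Cconj w - w)); nra).
    apply Cmod_eq_0 in Z. apply (f_equal Im) in Z. simpl in Z. simpl.
    change (snd w) with (Im w) in *. nra.
  - exists (s * (a k * (r * / 2) ^ k) / r), (r * d). split; [|split].
    + apply Rdiv_lt_0_compat; [|easy]. apply (Pos w); lra.
    + apply Rmult_lt_0_compat; lra.
    + intros x Hx. set (w2 := (x / RtoC r)%C).
      assert (Ex : x = (RtoC r * w2)%C) by (unfold w2; field; auto).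
      assert (Dx : Cmod (x - RtoC r * w) = r * Cmod (w2 - w)).
      { replace (x - RtoC r * w)%C with (RtoC r * (w2 - w))%C by (rewrite Ex; ring).
        rewrite Cmod_mult, Cmod_R, Rabs_pos_eq; lra. }
      rewrite Dx in Hx |- *. apply Rmult_le_reg_l in Hx; [|easy].
      assert (W2 : Cmod (w2 + 1) <= 2 * d).
      { replace (w2 + 1)%C with ((w2 - w) + (w + 1))%C by ring.
        eapply Rle_trans; [apply Cmod_triangle|]. lra. }
      assert (S2 := Sep w w2 Hfz W W2). rewrite <- Ex in S2.
      eapply Rle_trans; [|exact S2].
      replace (s * (a k * (r * / 2) ^ k) / r * (r * Cmod (w2 - w)))
        with (s * (a k * (r * / 2) ^ k) * Cmod (w2 - w)) by (field; lra).
      apply Rmult_le_compat_r; [apply Cmod_ge_0|]. apply (Pos w2 W2).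
Qed.

End SecondQuotients.

(** * Zeros in a disc, and the complex derivative *)

(** Taylor coefficients at 0 of the series with coefficients [c] divided by [x - z]. *)
Fixpoint quotient (c : nat -> C) (z : C) (k : nat) : C :=
  match k with
  | O => (- c O / z)%C
  | S k' => ((quotient c z k' - c k) / z)%C
  end.

(** Vanishing is expressed on the coefficients, so that it applies to successive quotients without
    naming their sums. *)
Definition null_sum (c : nat -> C) (z : C) : Prop :=
  forall eps, 0 < eps -> exists N0, forall N, (N0 <= N)%nat ->
  Cmod (csum (fun j => c j * z ^ j)%C N) < eps.

Lemma quotient_partial (c : nat -> C) (z : C) (k : nat) : z <> 0%C ->
  (quotient c z k * z ^ S k = - csum (fun j => c j * z ^ j) (S k))%C.
Proof.
  intros Hz; induction k as [|k IH].
  - simpl. field; easy.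
  - change (csum (fun j => c j * z ^ j)%C (S (S k)))
      with (csum (fun j => c j * z ^ j)%C (S k) + c (S k) * z ^ S k)%C.
    transitivity (quotient c z k * z ^ S k - c (S k) * z ^ S k)%C.
    + simpl. field; easy.
    + rewrite IH; ring.
Qed.

Lemma quotient_spec (c : nat -> C) (z x : C) (n : nat) : z <> 0%C ->
  (csum (fun j => c j * x ^ j) (S n)
   = (x - z) * csum (fun j => quotient c z j * x ^ j) (S n) - quotient c z n * x ^ S n)%C.
Proof.
  intros Hz; induction n as [|n IH].
  - simpl. field; easy.
  - change (csum (fun j => c j * x ^ j)%C (S (S n)))
      with (csum (fun j => c j * x ^ j)%C (S n) + c (S n) * x ^ S n)%C.
    change (csum (fun j => quotient c z j * x ^ j)%C (S (S n)))
      with (csum (fun j => quotient c z j * x ^ j)%C (S n) + quotient c z (S n) * x ^ S n)%C.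
    rewrite IH.
    assert (E : (c (S n) = quotient c z n - z * quotient c z (S n))%C)
      by (simpl; field; easy).
    rewrite (Cpow_S x (S n)).
    rewrite E; ring.
Qed.

Lemma pow_ratio_le (t r : R) (j : nat) : 0 <= t <= r -> 0 < r ->
  t ^ j / (3 * r) ^ j <= (/ 3) ^ j.
Proof.
  intros Ht Hr. unfold Rdiv. rewrite <- pow_inv, <- Rpow_mult_distr.
  apply pow_incr. split.
  - apply Rmult_le_pos; [lra | left; apply Rinv_0_lt_compat; lra].
  - apply (Rmult_le_reg_r (3 * r)); [lra|]. rewrite Rmult_assoc, Rinv_l; lra.
Qed.

(** At a root the partial sum is minus the tail, so [quotient c z k] is a tail divided by [z^(k+1)].
    The radius [3 * r] makes the tail geometric with ratio 1/3 and sum 3/2, and 3/2 divided by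
    [3 * r] is the new factor [1 / (2 * r)]. *)
Lemma quotient_bound (c : nat -> C) (z : C) (B r : R) :
  0 < r -> (forall j, Cmod (c j) <= B / (3 * r) ^ j) ->
  z <> 0%C -> Cmod z <= r -> null_sum c z ->
  forall k, Cmod (quotient c z k) <= B / (2 * r) / (3 * r) ^ k.
Proof.
  intros Hr Hc Hz Hzr H0 k.
  assert (Hz0 : 0 < Cmod z) by (apply Cmod_gt_0; easy).
  assert (HP : 0 < Cmod z ^ S k) by (apply pow_lt; easy).
  assert (HR : forall j, 0 < (3 * r) ^ j) by (intros; apply pow_lt; lra).
  assert (HB : 0 <= B).
  { generalize (Hc O) (Cmod_ge_0 (c O)); simpl. unfold Rdiv; rewrite Rinv_1; lra. }
  apply Rmult_le_reg_r with (Cmod z ^ S k); [easy|].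
  rewrite <- Cmod_pow, <- Cmod_mult, quotient_partial, Cmod_opp, Cmod_pow by easy.
  apply le_epsilon; intros eps Heps.
  destruct (H0 eps Heps) as [N0 HN0]. specialize (HN0 (S k + N0)%nat ltac:(lia)).
  rewrite csum_app in HN0.
  set (X := csum (fun j => c j * z ^ j)%C (S k)) in *.
  set (Y := csum _ N0) in *.
  assert (T := Cmod_triangle (X + Y) (- Y)). rewrite Cmod_opp in T.
  replace (X + Y + - Y)%C with X in T by ring.
  assert (HY : Cmod Y <= B / (2 * r) / (3 * r) ^ k * Cmod z ^ S k).
  { unfold Y. apply Rle_trans with
      (rsum (fun j => B / (3 * r) ^ S k * Cmod z ^ S k * (/ 3) ^ j) N0).
    - apply Cmod_csum_le; intros j _. rewrite Cmod_mult, Cmod_pow.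
      apply Rle_trans with (B / (3 * r) ^ (S k + j) * Cmod z ^ (S k + j)).
      { apply Rmult_le_compat_r; [apply pow_le; lra | apply Hc]. }
      rewrite !(pow_add _ (S k)).
      replace (B / ((3 * r) ^ S k * (3 * r) ^ j) * (Cmod z ^ S k * Cmod z ^ j))
        with (B / (3 * r) ^ S k * Cmod z ^ S k * (Cmod z ^ j / (3 * r) ^ j))
        by (field; split; apply Rgt_not_eq, HR).
      apply Rmult_le_compat_l; [|apply pow_ratio_le; lra].
      apply Rmult_le_pos; [|lra].
      apply Rmult_le_pos; [easy | left; apply Rinv_0_lt_compat, HR].
    - rewrite rsum_scal.
      assert (G := rsum_geom (/ 3) N0 ltac:(lra)).
      replace (B / (2 * r) / (3 * r) ^ k * Cmod z ^ S k)
        with (B / (3 * r) ^ S k * Cmod z ^ S k * (3 / 2)).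
      + apply Rmult_le_compat_l; [|eapply Rle_trans; [exact G|lra]].
        apply Rmult_le_pos; [|lra].
        apply Rmult_le_pos; [easy | left; apply Rinv_0_lt_compat, HR].
      + simpl ((3 * r) ^ S k). field. generalize (HR k); split; lra. }
  lra.
Qed.

(** In the finite identity [quotient_spec] the remainder is at most [B * (/ 3) ^ N], and [x - z] can
    be divided out because the roots are distinct. *)
Lemma null_sum_quotient (c : nat -> C) (z x : C) (B r : R) :
  0 < r -> (forall j, Cmod (c j) <= B / (3 * r) ^ j) ->
  z <> 0%C -> Cmod z <= r -> null_sum c z -> Cmod x <= r -> x <> z -> null_sum c x ->
  null_sum (quotient c z) x.
Proof.
  intros Hr Hc Hz Hzr H0 Hx Hxz Hcx eps Heps.
  assert (Q := quotient_bound c z B r Hr Hc Hz Hzr H0).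
  assert (HB : 0 <= B).
  { generalize (Hc O) (Cmod_ge_0 (c O)); simpl. unfold Rdiv; rewrite Rinv_1; lra. }
  assert (D : 0 < Cmod (x - z)).
  { apply Cmod_gt_0. intros H. apply Hxz. transitivity (x - z + z)%C; [ring | rewrite H; ring]. }
  destruct (Hcx (Cmod (x - z) * eps / 2)) as [N1 H1].
  { assert (0 < Cmod (x - z) * eps) by (apply Rmult_lt_0_compat; easy). lra. }
  destruct (pow_lt_1_zero (/ 3) ltac:(rewrite Rabs_pos_eq; lra)
    (Cmod (x - z) * eps / (2 * (B + 1)))) as [N2 H2].
  { apply Rdiv_lt_0_compat; [apply Rmult_lt_0_compat; easy | lra]. }
  exists (S (max N1 N2)); intros [|N] HN; [lia|].
  specialize (H1 (S N) ltac:(lia)). specialize (H2 N ltac:(lia)).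
  rewrite Rabs_pos_eq in H2 by (apply pow_le; lra).
  assert (E := quotient_spec c z x N Hz).
  set (A := csum (fun j => c j * x ^ j)%C (S N)) in *.
  set (G := csum (fun j => quotient c z j * x ^ j)%C (S N)) in *.
  apply Rmult_lt_reg_l with (Cmod (x - z)); [easy|].
  rewrite <- Cmod_mult.
  replace ((x - z) * G)%C with (A + quotient c z N * x ^ S N)%C by (rewrite E; ring).
  eapply Rle_lt_trans; [apply Cmod_triangle|].
  assert (L : Cmod (quotient c z N * x ^ S N) <= B * (/ 3) ^ N).
  { rewrite Cmod_mult, Cmod_pow.
    apply Rle_trans with (B / (2 * r) / (3 * r) ^ N * Cmod x ^ S N).
    - apply Rmult_le_compat_r; [apply pow_le, Cmod_ge_0 | apply Q].
    - generalize (pow_ratio_le (Cmod x) r N (conj (Cmod_ge_0 x) Hx) Hr); intros P.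
      assert (0 < (3 * r) ^ N) by (apply pow_lt; lra).
      replace (B / (2 * r) / (3 * r) ^ N * Cmod x ^ S N)
        with (B * (Cmod x / (2 * r)) * (Cmod x ^ N / (3 * r) ^ N)) by (simpl; field; lra).
      generalize (Cmod_ge_0 x); intros.
      assert (0 <= Cmod x / (2 * r) <= 1).
      { split; [apply Rmult_le_pos; [easy | left; apply Rinv_0_lt_compat; lra]|].
        apply Rle_div_l; lra. }
      assert (0 <= Cmod x ^ N / (3 * r) ^ N).
      { apply Rmult_le_pos; [apply pow_le; easy | left; apply Rinv_0_lt_compat; easy]. }
      apply Rmult_le_compat; try easy; [apply Rmult_le_pos; easy | nra]. }
  assert (M : B * (/ 3) ^ N <= Cmod (x - z) * eps / 2).
  { apply Rlt_le in H2. apply Rmult_le_compat_l with (r := B + 1) in H2; [|lra].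
    replace ((B + 1) * (Cmod (x - z) * eps / (2 * (B + 1))))
      with (Cmod (x - z) * eps / 2) in H2 by (field; lra).
    assert (0 < (/ 3) ^ N) by (apply pow_lt; lra). nra. }
  lra.
Qed.

(** Each division by a root costs a factor [1/2] in the bound for the constant term. *)
Lemma null_sum_count (l : list C) : forall (c : nat -> C) (B r : R),
  0 < r -> (forall j, Cmod (c j) <= B / (3 * r) ^ j) -> NoDup l ->
  (forall z, In z l -> z <> 0%C /\ Cmod z <= r /\ null_sum c z) ->
  Cmod (c O) <= B * (/ 2) ^ length l.
Proof.
  induction l as [|z l IH]; intros c B r Hr Hc Hl H.
  - generalize (Hc O); simpl; unfold Rdiv; rewrite Rinv_1; lra.
  - destruct (H z (or_introl eq_refl)) as [Hz [Hzr H0]].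
    inversion_clear Hl as [|? ? Hnot Hnd].
    assert (Q := IH (quotient c z) (B / (2 * r)) r Hr
      (quotient_bound c z B r Hr Hc Hz Hzr H0) Hnd).
    assert (I : Cmod (quotient c z 0) <= B / (2 * r) * (/ 2) ^ length l).
    { apply Q. intros x Hx. destruct (H x (or_intror Hx)) as [X1 [X2 X3]].
      repeat split; auto.
      apply (null_sum_quotient c z x B r); auto. intros ->; auto. }
    assert (E : c O = (- z * quotient c z 0)%C) by (simpl; field; easy).
    rewrite E, Cmod_mult, Cmod_opp. simpl length.
    replace (B * (/ 2) ^ S (length l)) with (r * (B / (2 * r) * (/ 2) ^ length l))
      by (simpl; field; lra).
    apply Rmult_le_compat; auto using Cmod_ge_0.
Qed.

(** If no list contained all points of [P], any duplicate-free list of them could be extended,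
    beyond length [M]. *)
Lemma finite_of_bounded (P : C -> Prop) (M : nat) :
  (forall l, NoDup l -> (forall z, In z l -> P z) -> (length l <= M)%nat) ->
  exists L, forall z, P z -> In z L.
Proof.
  intros H. apply NNPP; intros Hno.
  assert (G : forall n, exists l, NoDup l /\ (forall z, In z l -> P z) /\ length l = n).
  { induction n as [|n [l [H1 [H2 H3]]]].
    - exists nil; repeat split; [constructor | easy].
    - assert (Hz : exists z, P z /\ ~ In z l).
      { apply NNPP; intros Hz. apply Hno. exists l; intros z Pz.
        apply NNPP; intros Hin. apply Hz; exists z; easy. }
      destruct Hz as [z [Pz Hin]]. exists (z :: l); repeat split.
      + constructor; easy.
      + intros x [<-|Hx]; auto.
      + simpl; lia. }
  destruct (G (S M)) as [l [H1 [H2 H3]]]. specialize (H l H1 H2). lia.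
Qed.

(** * Cauchy estimates, zeros in a disc and differentiability of f *)

Section EntireSeries.
Variables (a : nat -> R) (f : C -> C).
Hypothesis a_pos : forall k, 0 < a k.
Hypothesis f_sum : forall z eps, 0 < eps -> exists N0, forall N, (N0 <= N)%nat ->
  Cmod (csum (fun j => RtoC (a j) * z ^ j)%C N - f z) < eps.

(** Since all coefficients are positive, a single term at the real point [r] is bounded by a partial
    sum there, hence by [|f r| + 1]. *)
Lemma cauchy_bound (r : R) : 0 < r -> exists B, 0 < B /\ forall j, a j <= B / r ^ j.
Proof.
  intros Hr. destruct (f_sum (RtoC r) 1 ltac:(lra)) as [N0 H].
  exists (Cmod (f (RtoC r)) + 1). split; [generalize (Cmod_ge_0 (f (RtoC r))); lra|].
  intros j. specialize (H (S j + N0)%nat ltac:(lia)).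
  set (u := fun j => a j * r ^ j).
  assert (U : forall i, 0 < u i) by (intros; apply Rmult_lt_0_compat; auto using pow_lt).
  rewrite (csum_ext _ (fun i => RtoC (u i))), csum_RtoC in H
    by (intros; unfold u; rewrite RtoC_mult, RtoC_pow; easy).
  assert (T := Cmod_triangle (RtoC (rsum u (S j + N0)) - f (RtoC r)) (f (RtoC r))).
  match type of T with Cmod ?x <= _ =>
    replace x with (RtoC (rsum u (S j + N0))) in T by ring end.
  rewrite Cmod_R, rsum_app in T. rewrite rsum_app in H. simpl (rsum u (S j)) in H, T.
  assert (G1 := rsum_ge0 u j (fun i _ => Rlt_le _ _ (U i))).
  assert (G2 := rsum_ge0 (fun i => u (S j + i)%nat) N0 (fun i _ => Rlt_le _ _ (U _))).
  assert (G3 := Rle_abs (rsum u j + u j + rsum (fun i => u (S j + i)%nat) N0)).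
  apply Rle_div_r; [apply pow_lt; easy|]. fold (u j). lra.
Qed.

(** A Jensen-type count: [n] distinct zeros force [a 0 <= B / 2^n], which bounds [n] because
    [a 0 > 0]. *)
Lemma zeros_in_disc (r : R) : 0 < r ->
  exists L, forall z, Cmod z <= r -> f z = 0%C -> In z L.
Proof.
  intros Hr. destruct (cauchy_bound (3 * r) ltac:(lra)) as [B [HB Ha]].
  destruct (pow_lt_1_zero (/ 2) ltac:(rewrite Rabs_pos_eq; lra) (a O / B)) as [M HM].
  { apply Rdiv_lt_0_compat; auto. }
  destruct (finite_of_bounded (fun z => Cmod z <= r /\ f z = 0%C) M) as [L HL].
  2: { exists L; intros; apply HL; easy. }
  intros l Hl HP. apply Nat.nlt_ge; intros Hlen.
  assert (f0 : f 0%C <> 0%C).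
  { intros F. destruct (f_sum 0%C (a O) (a_pos O)) as [N0 H].
    specialize (H (S N0) ltac:(lia)). rewrite F, csum_head, csum_0 in H.
    - replace (RtoC (a O) * 0 ^ 0 + 0 - 0)%C with (RtoC (a O)) in H by (simpl; ring).
      rewrite Cmod_R, Rabs_pos_eq in H; generalize (a_pos O); lra.
    - intros i _. rewrite Cpow_S; ring. }
  assert (Q := null_sum_count l (fun j => RtoC (a j)) B r Hr).
  assert (Q' : Cmod (RtoC (a O)) <= B * (/ 2) ^ length l).
  { apply Q; auto.
    - intros j. rewrite Cmod_R, Rabs_pos_eq; [apply Ha | left; apply a_pos].
    - intros z Hz. destruct (HP z Hz) as [Z1 Z2]. repeat split; auto.
      + intros ->; auto.
      + intros eps Heps. destruct (f_sum z eps Heps) as [N0 H]. exists N0; intros N HN.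
        specialize (H N HN). rewrite Z2 in H.
        match type of H with Cmod (?x - _) < _ =>
          replace (x - 0)%C with x in H by ring end. easy. }
  rewrite Cmod_R, Rabs_pos_eq in Q' by (left; apply a_pos).
  specialize (HM (length l) ltac:(lia)). rewrite Rabs_pos_eq in HM by (apply pow_le; lra).
  apply Rmult_lt_compat_l with (r := B) in HM; [|easy].
  replace (B * (a O / B)) with (a O) in HM by (field; lra). lra.
Qed.

Lemma INR_le_pow2 (n : nat) : INR n <= 2 ^ n.
Proof.
  induction n as [|n IH]; [simpl; lra|].
  rewrite S_INR; simpl. generalize (pow_R1_Rle 2 n ltac:(lra)); lra.
Qed.

(** The limit is the derivative of [f] at [z], as [divdiff j z z] is the derivative of the j-th
    monomial. Radius [4 * r] in the Cauchy estimate leaves [2^(-n)] after the factor [n <= 2^n]. *)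
Lemma csum_divdiff_lim (z : C) : exists l : C, forall eps, 0 < eps ->
  exists N0, forall N, (N0 <= N)%nat ->
  Cmod (csum (fun j => RtoC (a j) * divdiff j z z)%C N - l) < eps.
Proof.
  set (u := fun j => (RtoC (a j) * divdiff j z z)%C).
  set (r := Cmod z + 1). assert (Hr : 1 <= r) by (unfold r; generalize (Cmod_ge_0 z); lra).
  destruct (cauchy_bound (4 * r) ltac:(lra)) as [B [HB Ha]].
  assert (Ex : ex_series (V := C_CompleteNormedModule) u).
  { apply (ex_series_le (V := C_CompleteNormedModule) u (fun n => (4 * B) * (/ 2) ^ n)).
    - intros n. change (Cmod (u n) <= 4 * B * (/ 2) ^ n). unfold u.
      rewrite Cmod_mult, Cmod_R, Rabs_pos_eq by (left; apply a_pos).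
      assert (D := divdiff_bound' n z z r Hr ltac:(unfold r; lra) ltac:(unfold r; lra)).
      assert (P : 0 < r ^ n) by (apply pow_lt; lra).
      assert (P4 : 0 < 4 ^ n) by (apply pow_lt; lra).
      assert (P2 : 0 < 2 ^ n) by (apply pow_lt; lra).
      apply Rle_trans with (B / (4 * r) ^ n * (INR n * r ^ n)).
      { apply Rmult_le_compat; [left; apply a_pos | apply Cmod_ge_0 | apply Ha | exact D]. }
      replace (B / (4 * r) ^ n * (INR n * r ^ n)) with (B * INR n / 4 ^ n)
        by (rewrite Rpow_mult_distr; field; lra).
      assert (I := INR_le_pow2 n).
      rewrite pow_inv. replace (4 ^ n) with (2 ^ n * 2 ^ n)
        by (rewrite <- Rpow_mult_distr; f_equal; ring).
      apply Rle_trans with (B * 2 ^ n / (2 ^ n * 2 ^ n)).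
      + apply Rmult_le_compat_r; [left; apply Rinv_0_lt_compat; nra|].
        apply Rmult_le_compat_l; lra.
      + replace (B * 2 ^ n / (2 ^ n * 2 ^ n)) with (B * / 2 ^ n) by (field; lra).
        assert (0 < / 2 ^ n) by (apply Rinv_0_lt_compat; easy). nra.
    - apply (ex_series_scal_l (4 * B) (fun n => (/ 2) ^ n)).
      exists (/ (1 - / 2)). apply is_series_geom. rewrite Rabs_pos_eq; lra. }
  destruct Ex as [l Hl]. exists l. intros eps Heps.
  assert (Hb := Hl). unfold is_series in Hb.
  assert (S : forall n, sum_n (G := C_AbelianMonoid) u n = csum u (S n)).
  { induction n as [|n IH]; [rewrite sum_O; simpl; ring|].
    rewrite sum_Sn, IH. easy. }
  specialize (Hb (ball_norm l (mkposreal eps Heps))).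
  destruct Hb as [N0 HN0]; [apply locally_le_locally_norm, locally_norm_ball_norm|].
  exists (Datatypes.S N0); intros [|N] HN; [lia|].
  specialize (HN0 N ltac:(lia)). unfold ball_norm in HN0. simpl in HN0.
  change (Cmod (sum_n (G := C_AbelianMonoid) u N - l) < eps) in HN0.
  rewrite S in HN0. exact HN0.
Qed.

(** The remainder is [y - z] times the change of the divided differences from the nodes [z, z] to
    [y, z], which is Lipschitz. Radius [8 * r] absorbs the factor [n^2 <= 4^n] and leaves
    [2^(-n)]. *)
Lemma quadratic_remainder (z : C) : exists (l : C) (K : R), 0 < K /\
  forall y, Cmod (y - z) <= 1 ->
  Cmod (f y - f z - (y - z) * l) <= K * Cmod (y - z) ^ 2.
Proof.
  destruct (csum_divdiff_lim z) as [l Hl].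
  set (r := Cmod z + 1). assert (Hr : 1 <= r) by (unfold r; generalize (Cmod_ge_0 z); lra).
  destruct (cauchy_bound (8 * r) ltac:(lra)) as [B [HB Ha]].
  exists l, (2 * B); split; [lra|]. intros y Hy.
  assert (Yr : Cmod y <= r).
  { replace y with ((y - z) + z)%C by ring. eapply Rle_trans; [apply Cmod_triangle|].
    unfold r; lra. }
  assert (Zr : Cmod z <= r) by (unfold r; lra).
  set (h := Cmod (y - z)). assert (Hh : 0 <= h) by apply Cmod_ge_0.
  apply le_epsilon; intros eps Heps.
  destruct (f_sum y (eps / 3) ltac:(lra)) as [N1 H1].
  destruct (f_sum z (eps / 3) ltac:(lra)) as [N2 H2].
  destruct (Hl (eps / 3) ltac:(lra)) as [N3 H3].
  set (N := max N1 (max N2 N3)).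
  specialize (H1 N ltac:(lia)). specialize (H2 N ltac:(lia)). specialize (H3 N ltac:(lia)).
  assert (E : (csum (fun j => RtoC (a j) * y ^ j) N - csum (fun j => RtoC (a j) * z ^ j) N
    - (y - z) * csum (fun j => RtoC (a j) * divdiff j z z) N
    = (y - z) * csum (fun j => RtoC (a j) * (divdiff j y z - divdiff j z z)) N)%C).
  { rewrite <- csum_minus, <- !csum_scal, <- csum_minus.
    apply csum_ext; intros j _.
    transitivity (RtoC (a j) * (y ^ j - z ^ j)
      - (y - z) * (RtoC (a j) * divdiff j z z))%C; [ring|].
    rewrite <- divdiff_spec; ring. }
  assert (Q : Cmod (csum (fun j => RtoC (a j) * (divdiff j y z - divdiff j z z))%C N)
    <= 2 * (B * h)).
  { eapply Rle_trans; [|apply rsum_geom_half; nra].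
    apply Cmod_csum_le; intros n _.
    rewrite Cmod_mult, Cmod_R, Rabs_pos_eq by (left; apply a_pos).
    assert (D := divdiff_lipschitz n y z z z r Hr Yr Zr Zr Zr).
    replace (z - z)%C with (RtoC 0) in D by ring. rewrite Cmod_0, Rplus_0_r in D. fold h in D.
    assert (P : 0 < r ^ n) by (apply pow_lt; lra).
    assert (P2 : 0 < 2 ^ n) by (apply pow_lt; lra).
    apply Rle_trans with (B / (8 * r) ^ n * (INR n ^ 2 * r ^ n * h)).
    { apply Rmult_le_compat; [left; apply a_pos | apply Cmod_ge_0 | apply Ha | exact D]. }
    assert (I := INR_le_pow2 n).
    replace (8 * r) with (2 * 2 * 2 * r) by ring. rewrite !Rpow_mult_distr, pow_inv.
    replace (B / (2 ^ n * 2 ^ n * 2 ^ n * r ^ n) * (INR n ^ 2 * r ^ n * h))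
      with (B * h * ((INR n / 2 ^ n) ^ 2 * / 2 ^ n)) by (field; lra).
    apply Rmult_le_compat_l; [nra|].
    assert (0 <= INR n / 2 ^ n <= 1).
    { split; [apply Rmult_le_pos; [apply pos_INR | left; apply Rinv_0_lt_compat; easy]|].
      apply Rle_div_l; lra. }
    assert (0 < / 2 ^ n) by (apply Rinv_0_lt_compat; easy).
    set (q := INR n / 2 ^ n) in *; clearbody q. assert (q ^ 2 <= 1) by nra. nra. }
  set (SY := csum (fun j => RtoC (a j) * y ^ j)%C N) in *.
  set (SZ := csum (fun j => RtoC (a j) * z ^ j)%C N) in *.
  set (SD := csum (fun j => RtoC (a j) * divdiff j z z)%C N) in *.
  set (SE := csum (fun j => RtoC (a j) * (divdiff j y z - divdiff j z z))%C N) in *.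
  replace (f y - f z - (y - z) * l)%C
    with ((y - z) * SE + (- (SY - f y) + ((SZ - f z) + (y - z) * (SD - l))))%C
    by (rewrite <- E; ring).
  eapply Rle_trans; [apply Cmod_triangle|].
  eapply Rle_trans; [apply Rplus_le_compat_l, Cmod_triangle|].
  eapply Rle_trans; [apply Rplus_le_compat_l, Rplus_le_compat_l, Cmod_triangle|].
  rewrite Cmod_opp, !Cmod_mult. fold h.
  assert (h * Cmod SE <= h * (2 * (B * h))) by (apply Rmult_le_compat_l; easy).
  assert (h * Cmod (SD - l) <= 1 * (eps / 3))
    by (apply Rmult_le_compat; try easy; [apply Cmod_ge_0 | lra]).
  lra.
Qed.

Lemma simple_of_lower_bound (z : C) (s e : R) : f z = 0%C -> 0 < s -> 0 < e ->
  (forall x, Cmod (x - z) <= e -> s * Cmod (x - z) <= Cmod (f x)) -> simple_zero f z.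
Proof.
  intros Hz Hs He H. split; [easy|].
  destruct (quadratic_remainder z) as [l [K [HK Q]]].
  exists l; split.
  - split; [apply is_linear_scal_l|]. intros x Hx eps.
    rewrite <- (is_filter_lim_locally_unique (V := AbsRing_NormedModule C_AbsRing) _ _ Hx).
    clear x Hx.
    assert (Hm : 0 < Rmin 1 (eps / K)).
    { apply Rmin_glb_lt; [lra | apply Rdiv_lt_0_compat; [apply cond_pos | easy]]. }
    exists (mkposreal _ Hm). intros y Hy.
    change (Cmod (y - z) < Rmin 1 (eps / K)) in Hy.
    change (Cmod (f y - f z - (y - z) * l) <= eps * Cmod (y - z)).
    assert (M1 := Rmin_l 1 (eps / K)). assert (M2 := Rmin_r 1 (eps / K)).
    eapply Rle_trans; [apply Q; lra|].
    replace (K * Cmod (y - z) ^ 2) with (K * Cmod (y - z) * Cmod (y - z)) by ring.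
    apply Rmult_le_compat_r; [apply Cmod_ge_0|].
    apply Rle_trans with (K * (eps / K)); [apply Rmult_le_compat_l; lra|].
    right; field; lra.
  - intros ->.
    (* With zero derivative, [s * h <= |f (z + h)| <= K * h^2], which fails once
       [K * h <= s / 2]. *)
    set (h := Rmin (Rmin 1 e) (s / (2 * K))).
    assert (Hh : 0 < h).
    { repeat apply Rmin_glb_lt; try lra. apply Rdiv_lt_0_compat; lra. }
    assert (h1 : h <= 1) by (eapply Rle_trans; [apply Rmin_l | apply Rmin_l]).
    assert (h2 : h <= e) by (eapply Rle_trans; [apply Rmin_l | apply Rmin_r]).
    assert (h3 : K * h <= s / 2).
    { apply Rle_trans with (K * (s / (2 * K))).
      - apply Rmult_le_compat_l; [lra | apply Rmin_r].
      - right; field; lra. }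
    assert (E : Cmod (z + RtoC h - z) = h).
    { replace (z + RtoC h - z)%C with (RtoC h) by ring. rewrite Cmod_R, Rabs_pos_eq; lra. }
    specialize (H (z + RtoC h)%C ltac:(lra)). specialize (Q (z + RtoC h)%C ltac:(lra)).
    rewrite Hz in Q.
    replace (f (z + RtoC h) - 0 - (z + RtoC h - z) * 0)%C with (f (z + RtoC h)%C) in Q by ring.
    rewrite E in H, Q. nra.
Qed.

End EntireSeries.

(** * From the hypotheses on f to the theorem *)

Lemma partial_sums (a : nat -> R) (f : C -> C) : entire_with_coeffs a f ->
  forall z eps, 0 < eps -> exists N0, forall N, (N0 <= N)%nat ->
  Cmod (csum (fun j => RtoC (a j) * z ^ j)%C N - f z) < eps.
Proof.
  intros Hf z eps Heps. assert (Hl := Hf z). unfold is_pseries, is_series in Hl.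
  specialize (Hl (ball_norm (V := C_NormedModule) (f z) (mkposreal eps Heps))).
  destruct Hl as [N0 HN0]; [apply locally_le_locally_norm, locally_norm_ball_norm|].
  exists (S N0); intros [|N] HN; [lia|].
  specialize (HN0 N ltac:(lia)).
  match type of HN0 with ball_norm _ _ ?x => replace x
    with (csum (fun j => RtoC (a j) * z ^ j)%C (S N)) in HN0 end; [exact HN0|].
  assert (Pw : forall n, pow_n (K := C_AbsRing) z n = (z ^ n)%C).
  { induction n as [|n IH]; [easy|]. simpl. rewrite IH. easy. }
  clear HN HN0. induction N as [|N IH].
  - rewrite sum_O, Pw. change (csum (fun j => RtoC (a j) * z ^ j)%C 1
      = (z ^ 0 * RtoC (a O))%C). simpl. ring.
  - rewrite sum_Sn, <- IH, Pw.
    change (csum (fun j => RtoC (a j) * z ^ j)%C (S (S N))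
      = (csum (fun j => RtoC (a j) * z ^ j) (S N) + z ^ S N * RtoC (a (S N)))%C).
    change (csum (fun j => RtoC (a j) * z ^ j)%C (S (S N)))
      with (csum (fun j => RtoC (a j) * z ^ j) (S N) + RtoC (a (S N)) * z ^ S N)%C.
    ring.
Qed.

Lemma two_cbrt_two : 5 / 2 <= 2 * Rpower 2 (1 / 3).
Proof.
  assert (P : 0 < Rpower 2 (1 / 3)) by apply exp_pos.
  assert (E : Rpower 2 (1 / 3) ^ 3 = 2).
  { rewrite <- Rpower_pow by easy. rewrite Rpower_mult. simpl INR.
    replace (1 / 3 * (1 + 1 + 1)) with 1 by field. apply Rpower_1; lra. }
  destruct (Rle_lt_dec (5 / 2) (2 * Rpower 2 (1 / 3))); [easy|].
  (* (5/4)^3 = 125/64 is below 2. *)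
  assert (Rpower 2 (1 / 3) ^ 3 <= (5 / 4) ^ 3) by (apply pow_incr; lra). lra.
Qed.

Theorem theorem1 (a : nat -> R) (f : C -> C) :
  entire_with_coeffs a f ->
  (forall k : nat, 0 < a k) ->
  2 * Rpower 2 (1 / 3) <= second_quotient a 2 ->
  (forall n : nat, (2 <= n)%nat -> second_quotient a n <= second_quotient a (S n)) ->
  exists L : list C,
    forall z : C, f z = 0%C -> In z L \/ (Im z = 0 /\ simple_zero f z).
Proof.
  intros Hf Ha H2 Hmono.
  assert (f_sum := partial_sums a f Hf).
  assert (Sh : forall k, shrink a k = / second_quotient a (S (S k))).
  { intros k. unfold shrink, ratio, second_quotient.
    replace (S (S k) - 1)%nat with (S k) by lia. replace (S (S k) - 2)%nat with k by lia.
    generalize (Ha k) (Ha (S k)) (Ha (S (S k))); intros; field; lra. }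
  assert (Hq : forall k, 5 / 2 <= second_quotient a (S (S k))).
  { induction k as [|k IH].
    - generalize two_cbrt_two; lra.
    - generalize (Hmono (S (S k)) ltac:(lia)); lra. }
  assert (S0 : shrink a 0 <= 2 / 5).
  { rewrite Sh. apply Rle_trans with (/ (5 / 2)); [|lra].
    apply Rinv_le_contravar; [lra | apply Hq]. }
  assert (Sd : forall k, shrink a (S k) <= shrink a k).
  { intros k. rewrite !Sh. apply Rinv_le_contravar.
    - generalize (Hq k); lra.
    - apply Hmono; lia. }
  destruct (far_zeros a Ha S0 Sd f f_sum) as [R0 [HR0 Far]].
  destruct (zeros_in_disc a f Ha f_sum R0 HR0) as [L HL].
  exists L; intros z Hz.
  destruct (Rle_lt_dec (Cmod z) R0) as [Hle|Hlt]; [left; auto|right].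
  destruct (Far z (Rlt_le _ _ Hlt) Hz) as [Him [s [e [Hs [He Hlow]]]]].
  split; [easy|]. apply (simple_of_lower_bound a f Ha f_sum z s e); easy.
Qed.
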